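(* Let $\psi \in L^1(\mathbb{R}_+^{\times})$ with $\int_1^{\infty}\psi(x)\,\frac{dx}{x} = 1$ and $Z(\tilde{\psi}) = \emptyset$. Then for every $f \in L^{\infty}(\mathbb{R}_+^{\times})$ and every $\alpha$, \[\lim_{x\to\infty}\int_1^x f(t)\psi(x/t)\,\frac{dt}{t} = \alpha\] if and only if \[\lim_{x\to\infty}\int_x^{\infty} f(t)\psi(t/x)\,\frac{dt}{t} = \alpha.\] In other words, the summability methods $M_\psi$ and $M_\psi^*$ defined by these two limits are equivalent.
   Context: $\mathbb{R}^{\times} = (0,\infty)$ with Haar measure $dt/t$, $\mathbb{R}_+^{\times} = [1,\infty)$ with measure $dt/t$; functions are complex-valued. $\tilde{\psi} \in L^1(\mathbb{R}^{\times})$ equals $\psi$ on $[1,\infty)$ and $0$ on $(0,1)$. For $g \in L^1(\mathbb{R}^\times)$, $\hat g(x) = \int_0^\infty g(t)t^{-ix}\,\frac{dt}{t}$ and $Z(g) = \{x \in \mathbb{R}: \hat g(x) = 0\}$. *)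

(* Defs.v *)
From HB Require Import structures.
From mathcomp Require Import all_boot all_order all_algebra.
From mathcomp Require Import all_classical all_reals all_analysis.
From mathcomp Require Import complex.
Set Implicit Arguments. Unset Strict Implicit. Unset Printing Implicit Defensive.
Import Order.TTheory GRing.Theory Num.Theory.
Import numFieldNormedType.Exports.
Local Open Scope classical_set_scope.
Local Open Scope ring_scope.

Section Defs.
Variable R : realType.
Local Notation mu := (@lebesgue_measure R).

(* R_+^x = [1, oo) ; the Haar measure dt/t is realised as the density 1/t
   w.r.t. Lebesgue measure. *)
Definition Rplus_mul : set R := `[1, +oo[%classic.

Definition cint_dt (D : set R) (g : R -> R[i]) : R[i] :=
  Complex (Rintegral mu D (fun t => complex.Re (g t) / t))
          (Rintegral mu D (fun t => complex.Im (g t) / t)).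

Definition cL1 (D : set R) (g : R -> R[i]) : Prop :=
  mu.-integrable D (fun t => (complex.Re (g t) / t)%:E) /\
  mu.-integrable D (fun t => (complex.Im (g t) / t)%:E).

(* f in L^oo(D, dt/t): measurable and essentially bounded; dt/t and Lebesgue
   measure have the same null sets on (0,oo). *)
Definition cLinfty (D : set R) (f : R -> R[i]) : Prop :=
  measurable_fun D (fun t => complex.Re (f t)) /\ measurable_fun D (fun t => complex.Im (f t)) /\
  exists M : R, {ae mu, forall t, D t -> complex.Re (f t) ^+ 2 + complex.Im (f t) ^+ 2 <= M}.

(* t^{-ix} = exp(-i x ln t) = cos (x ln t) - i sin (x ln t) *)
Definition tpow_mix (t x : R) : R[i] :=
  Complex (cos (x * ln t)) (- sin (x * ln t)).

Definition ext_tilde (psi : R -> R[i]) (t : R) : R[i] :=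
  if (1 <= t) then psi t else 0.

Definition hat (g : R -> R[i]) (x : R) : R[i] :=
  cint_dt `]0, +oo[%classic (fun t => g t * tpow_mix t x).

Definition Zset (g : R -> R[i]) : set R := [set x | hat g x = 0].

Definition clim_pinfty (F : R -> R[i]) (a : R[i]) : Prop :=
  (fun x => complex.Re (F x)) @ +oo --> complex.Re a /\ (fun x => complex.Im (F x)) @ +oo --> complex.Im a.

Definition Mpsi (psi f : R -> R[i]) (x : R) : R[i] :=
  cint_dt `[1, x]%classic (fun t => f t * psi (x / t)).

Definition Mpsi_star (psi f : R -> R[i]) (x : R) : R[i] :=
  cint_dt `[x, +oo[%classic (fun t => f t * psi (t / x)).

End Defs.

(* Main.v *)
(* In the variable s = ln t the two methods are convolutions of f with P(s) = psi(e^s) and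
   with P(-s); both kernels have integral 1 and a Fourier transform without zeros, so after
   subtracting alpha from f it is enough to prove Wiener's theorem: if f is bounded, p is
   integrable, the transform of p has no zeros and f * p tends to 0 at +oo, then f * q
   tends to 0 for every integrable q.

   Let K_a(t) = (1 - cos(a t)) / t^2 and let V_e be the de la Vallee Poussin kernel, so that
   K_a * V_e = K_a for a <= e. Suppose first that c, the integral of p, is not 0. Since
   V_e * p - c V_e tends to 0 in L1 as e -> 0, for a <= e small H = f * K_a = H * V_e satisfies
   limsup |c H| <= (|c| / 2) limsup |H|, hence H -> 0. Modulating by e^{ixs} gives
   f * (cos(x .) K_a) -> 0 with an e uniform for |x| <= N, and the Fejer summation identity
   writes K_N as a finite combination of the kernels cos(j a .) K_a with |j a| <= N. So
   f * K_N -> 0 for all N, and K_N is (up to a constant) an approximate identity.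

   Complex functions are handled as pairs of real ones. *)
Require Import Defs.
From HB Require Import structures.
From mathcomp Require Import all_boot all_order all_algebra.
From mathcomp Require Import all_classical all_reals all_analysis.
From mathcomp Require Import measurable_realfun complex ring lra.
Set Implicit Arguments. Unset Strict Implicit. Unset Printing Implicit Defensive.
Import Order.TTheory GRing.Theory Num.Theory.
Import numFieldNormedType.Exports.
Local Open Scope classical_set_scope.
Local Open Scope ring_scope.

(** * Affine substitutions in Lebesgue integrals *)

Section ChangeOfVariables.
Context {R : realType}.
Local Notation mu := (@lebesgue_measure R).
Local Open Scope ereal_scope.

(** The contraction takes the place of a division by the Fourier transform of p: on functions with
    frequencies in [-e, e], convolution with p is the scalar c up to an operator of small L1 norm,
    so it can be inverted there. What has to be secured is one e for the whole range |x| <= N. The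
    error is at most the integral of |p| times the L1 modulus of continuity of V_e, and the factor
    to be divided by is at least the minimum of the modulus of the transform on [-N, N]; the first
    is unaffected by modulating p, the second is positive by compactness.

    That K_a has frequencies at most a is expressed only by K_a * V_e = K_a. Both kernels are
    elementary, and everything about their transforms follows from the integral of K_a being
    proportional to |a|. As V_e is bounded as well as integrable, V_e * p is defined at every point,
    and no convolution of two merely integrable functions is formed.

    One complex limit is two real limits in which f1 and f2 are coupled, so the contraction acts on
    max(|H1|, |H2|). Its factor is 3/4: 1/2 as announced, and 1/4 for terms that tend to 0. *)

Lemma measurable_affine (a b : R) : measurable_fun setT (fun x : R => a * x + b)%R.
Proof. by apply: measurable_funD => //; exact: measurable_funM. Qed.

Lemma preimage_affine_itvoc (a b c d : R) : (0 < a)%R ->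
  (fun x : R => a * x + b)%R @^-1` `]c, d] = `]((c - b) / a)%R, ((d - b) / a)%R]%classic.
Proof.
move=> a0; apply/seteqP; split=> x /=; rewrite !in_itv/=;
  rewrite ltr_pdivrMr// ler_pdivlMr// ltrBlDr lerBrDr; by rewrite [(x * a)%R]mulrC.
Qed.

(** By uniqueness of Lebesgue measure: the image of [mu] under the affine map, scaled by [a], has
    the right value on half-open intervals. *)
Lemma lebesgue_measure_affine (a b : R) (A : set R) : (0 < a)%R -> measurable A ->
  mu A = a%:E * mu ((fun x => a * x + b)%R @^-1` A).
Proof.
move=> a0 mA.
pose phi : measurableTypeR R -> measurableTypeR R := fun x => (a * x + b)%R.
have mphi : measurable_fun setT phi := measurable_affine a b.
pose nu : {measure set _ -> \bar R} := mscale (NngNum (ltW a0)) (pushforward mu phi).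
have -> : a%:E * mu ((fun x => a * x + b)%R @^-1` A) = nu mphi A by [].
apply: lebesgue_measure_unique => //= _ [[c d] _ <-]/=.
rewrite /mscale/= /pushforward preimage_affine_itvoc// !lebesgue_measure_itv/= !lte_fin.
rewrite ltr_pM2r ?invr_gt0// ltrD2r; case: ifPn => _; last by rewrite mule0.
by rewrite -!EFinB -EFinM -mulrBl; congr EFin; field; rewrite gt_eqF.
Qed.

Lemma ge0_integral_affine_pos (a b : R) (h : R -> \bar R) : (0 < a)%R ->
  measurable_fun setT h -> (forall x, 0 <= h x) ->
  \int[mu]_x h x = a%:E * \int[mu]_x h (a * x + b)%R.
Proof.
move=> a0 mh h0.
pose phi : measurableTypeR R -> measurableTypeR R := fun x => (a * x + b)%R.
have mphi : measurable_fun setT phi := measurable_affine a b.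
pose nu : {measure set _ -> \bar R} := mscale (NngNum (ltW a0)) (pushforward mu phi).
transitivity (\int[nu mphi]_x h x).
  by apply: eq_measure_integral => A mA _; exact: (lebesgue_measure_affine b a0 mA).
rewrite ge0_integral_mscale//; congr (_ * _).
by rewrite ge0_integral_pushforward.
Qed.

Lemma ge0_integral_opp (h : R -> \bar R) :
  measurable_fun setT h -> (forall x, 0 <= h x) ->
  \int[mu]_x h x = \int[mu]_x h (- x)%R.
Proof.
move=> mh h0.
have mN : measurable_fun setT (-%R : measurableTypeR R -> measurableTypeR R).
  exact: oppr_measurable.
pose nu : {measure set _ -> \bar R} := pushforward mu (-%R : measurableTypeR R -> measurableTypeR R).
transitivity (\int[nu mN]_x h x).
  by apply: eq_measure_integral => A mA _; exact/esym/lebesgue_measureN.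
by rewrite ge0_integral_pushforward.
Qed.

Lemma ge0_integral_affine (a b : R) (h : R -> \bar R) : a != 0%R ->
  measurable_fun setT h -> (forall x, 0 <= h x) ->
  \int[mu]_x h x = `|a|%:E * \int[mu]_x h (a * x + b)%R.
Proof.
move=> a0 mh h0; have [ap|an|/eqP] := ltgtP a 0%R; last by rewrite (negbTE a0).
- rewrite ltr0_norm//.
  rewrite (ge0_integral_affine_pos (a := - a) b) ?oppr_gt0//; congr (_ * _).
  rewrite ge0_integral_opp//.
    by under eq_integral do rewrite mulrNN.
  by apply: measurableT_comp => //; exact: measurable_affine.
- by rewrite gtr0_norm// -ge0_integral_affine_pos.
Qed.

End ChangeOfVariables.

(** * Integrable real functions on the line, and Fubini for real-valued integrals *)

Section LebesgueFunctions.
Context {R : realType}.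
Local Notation mu := (@lebesgue_measure R).
Implicit Types (p q w g : R -> R).

Definition L1 p := mu.-integrable setT (EFin \o p).
(** The bound holds everywhere, not just almost everywhere, so that it can be used at each
    translated argument; [bounded_representative] brings an essentially bounded function to this
    form. *)
Definition bounded_meas g :=
  measurable_fun setT g /\ exists M : R, forall x, `|g x| <= M.

Lemma L1_measurable p : L1 p -> measurable_fun setT p.
Proof. by move/measurable_int/measurable_EFinP. Qed.

Lemma eq_L1 p q : p =1 q -> L1 p -> L1 q.
Proof. by move=> /funext ->. Qed.

Lemma le_L1 p q : measurable_fun setT p -> (forall x, `|p x| <= q x) -> L1 q -> L1 p.
Proof.
move=> mp pq; apply: le_integrable => //; first exact/measurable_EFinP.
by move=> x _ /=; rewrite lee_fin (le_trans (pq x))// ler_norm.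
Qed.

Lemma L1_norm p : L1 p -> L1 (fun x => `|p x|).
Proof. exact: integrable_norm. Qed.

Lemma L1D p q : L1 p -> L1 q -> L1 (fun x => p x + q x).
Proof. by move=> ip iq; exact: (integrableD measurableT ip iq). Qed.

Lemma L1B p q : L1 p -> L1 q -> L1 (fun x => p x - q x).
Proof. by move=> ip iq; exact: (integrableB measurableT ip iq). Qed.

Lemma L1Zl (k : R) p : L1 p -> L1 (fun x => k * p x).
Proof. by move=> ip; exact: (integrableZl measurableT k ip). Qed.

Lemma L1_bmM g p : bounded_meas g -> L1 p -> L1 (fun x => g x * p x).
Proof.
move=> [mg [M gM]] ip; apply: (@le_L1 _ (fun x => M * `|p x|)).
- by apply: measurable_funM => //; exact: L1_measurable.
- by move=> x; rewrite normrM ler_wpM2r.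
- exact/L1Zl/L1_norm.
Qed.

Lemma norm_Rintegral_le p q : L1 p -> L1 q -> (forall x, `|p x| <= q x) ->
  `|\int[mu]_x p x| <= \int[mu]_x q x.
Proof.
move=> ip iq pq; apply: (le_trans (le_normr_Rintegral measurableT ip)).
by apply: le_Rintegral => //; exact: L1_norm.
Qed.

Lemma EFin_Rintegral p : L1 p -> (\int[mu]_x p x)%:E = (\int[mu]_x (p x)%:E)%E.
Proof. by move=> ip; rewrite /Rintegral fineK//; exact: integrable_fin_num. Qed.

Lemma L1P p : measurable_fun setT p -> (\int[mu]_x `|p x|%:E < +oo)%E -> L1 p.
Proof. by move=> mp ip; apply/integrableP; split => //; exact/measurable_EFinP. Qed.

Lemma L1_lty p : L1 p -> (\int[mu]_x `|p x|%:E < +oo)%E.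
Proof. by move/integrableP => []. Qed.

Lemma measurable_comp_affine (a b : R) p : measurable_fun setT p ->
  measurable_fun setT (fun x => p (a * x + b)).
Proof. by move=> mp; apply: measurableT_comp => //; exact: measurable_affine. Qed.

Lemma L1_affine (a b : R) p : a != 0 -> L1 p -> L1 (fun x => p (a * x + b)).
Proof.
move=> a0 ip; have mp := L1_measurable ip; apply: L1P.
  exact: measurable_comp_affine.
have := L1_lty ip.
rewrite (ge0_integral_affine b a0 (h := fun x => `|p x|%:E))//; last first.
  by apply/measurable_EFinP; exact: measurableT_comp.
by rewrite !ltey; apply: contraNN => /eqP ->; rewrite gt0_muley// lte_fin normr_gt0.
Qed.

Lemma Rintegral_affine (a b : R) p : a != 0 -> L1 p ->
  \int[mu]_x p x = `|a| * \int[mu]_x p (a * x + b).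
Proof.
move=> a0 ip; have ip' := L1_affine b a0 ip.
have mp : measurable_fun setT (EFin \o p) := measurable_int _ ip.
apply: EFin_inj; rewrite EFinM !EFin_Rintegral//.
rewrite integralE [in RHS]integralE.
rewrite (ge0_integral_affine b a0 (h := (EFin \o p)^\+%E))//; last exact: measurable_funepos.
rewrite (ge0_integral_affine b a0 (h := (EFin \o p)^\-%E))//; last exact: measurable_funeneg.
rewrite [RHS]muleBr//; last first.
  apply: fin_num_adde_defl; rewrite fin_numN.
  exact: (integrable_neg_fin_num measurableT ip').
by congr (_ * _ - _ * _)%E; apply: eq_integral => x _; rewrite ?funeposE ?funenegE.
Qed.

Lemma Rintegral_dominated_cvg (f_ : nat -> R -> R) f G :
  (forall n, measurable_fun setT (f_ n)) ->
  (forall x, f_ n x @[n --> \oo] --> f x) ->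
  L1 G -> (forall n x, `|f_ n x| <= G x) ->
  \int[mu]_x f_ n x @[n --> \oo] --> \int[mu]_x f x.
Proof.
move=> mf ff iG fG.
have mff : measurable_fun setT f.
  by apply: (measurable_fun_cvg (h := f_)) => // x _; exact: ff.
have [iff _ cf] : [/\ mu.-integrable setT (EFin \o f),
    (\int[mu]_x `|(f_ n x)%:E - (f x)%:E|)%E @[n --> \oo] --> 0%E &
    (\int[mu]_x (f_ n x)%:E)%E @[n --> \oo] --> (\int[mu]_x (f x)%:E)%E].
  apply: (@dominated_convergence _ _ _ mu setT measurableT _ _ (EFin \o G)) => //.
  - by move=> n; apply/measurable_EFinP; exact: mf.
  - exact/measurable_EFinP.
  - by apply: aeW => x _; apply: cvg_EFin; [exact: nearW|exact: ff].
  - by apply: aeW => x n _ /=; rewrite lee_fin fG.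
move: cf; rewrite -(EFin_Rintegral iff); exact: fine_cvg.
Qed.

(** Tonelli, integrating in [y] before [x]. The majorant [k] may depend on both variables because in
    the applications it involves translates such as [v (y - x)], whose integral in [y] is bounded
    uniformly in [x]. *)
Lemma integrable_prod (f : R * R -> R) p (k : R -> R -> R) (C : R) :
  measurable_fun setT f -> L1 p -> (forall x, L1 (k x)) -> (forall x y, 0 <= k x y) ->
  (forall x, \int[mu]_y k x y <= C) ->
  (forall x y, `|f (x, y)| <= `|p x| * k x y) ->
  (mu \x mu)%E.-integrable setT (EFin \o f).
Proof.
move=> mf ip ik k0 kC fpk; apply/integrable12ltyP; first exact/measurable_EFinP.
have mf1 x : measurable_fun setT (fun y => f (x, y)) by exact: measurable_fun_pair2.
have mfE : measurable_fun setT (fun z => `|(f z)%:E|%E).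
  by apply: measurableT_comp => //; exact/measurable_EFinP.
have ipC : L1 (fun x => `|p x| * C).
  by apply: (eq_L1 _ (L1Zl C (L1_norm ip))) => x; rewrite mulrC.
apply: (@le_lt_trans _ _ (\int[mu]_x (`|p x| * C)%:E)%E); last first.
  by rewrite -EFin_Rintegral ?ltry.
apply: ge0_le_integral => //.
- by move=> x _; exact: integral_ge0.
- exact: (@measurable_fun_fubini_tonelli_F _ _ _ _ _ mu _ mfE (fun=> abse_ge0 _)).
- by apply/measurable_EFinP; exact: L1_measurable.
- move=> x _; have ipk : L1 (fun y => `|p x| * k x y) by exact: L1Zl.
  apply: (@le_trans _ _ (\int[mu]_y (`|p x| * k x y)%:E)%E).
    apply: ge0_le_integral => //.
    + by apply: measurableT_comp => //; apply/measurable_EFinP; exact: mf1.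
    + by apply/measurable_EFinP; exact: L1_measurable.
    + by move=> y _; rewrite /= lee_fin.
  by rewrite -(EFin_Rintegral ipk) (RintegralZl _ _ (ik x))// lee_fin ler_wpM2l.
Qed.

(** Integrability of the sections in [x] is asked for every [y], so that the real-valued inner
    integral coincides with [fubini_G] at every point. *)
Lemma L1_Rintegral_Fubini (f : R * R -> R) p (k : R -> R -> R) (C : R) :
  measurable_fun setT f -> L1 p -> (forall x, L1 (k x)) -> (forall x y, 0 <= k x y) ->
  (forall x, \int[mu]_y k x y <= C) ->
  (forall x y, `|f (x, y)| <= `|p x| * k x y) ->
  (forall y, L1 (fun x => f (x, y))) ->
  L1 (fun y => \int[mu]_x f (x, y)) /\
  \int[mu]_x \int[mu]_y f (x, y) = \int[mu]_y \int[mu]_x f (x, y).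
Proof.
move=> mf ip ik k0 kC fpk i2.
have imf := integrable_prod mf ip ik k0 kC fpk.
have i1 x : L1 (fun y => f (x, y)).
  by apply: (le_L1 _ (fpk x)); [exact: measurable_fun_pair2|exact: L1Zl].
split.
  have GE : EFin \o (fun y => \int[mu]_x f (x, y)) = fubini_G mu (EFin \o f).
    by apply/funext => y; rewrite /= EFin_Rintegral.
  have mG := measurable_fubini_G imf.
  apply/integrableP; rewrite GE; split=> //.
  have mfE : measurable_fun setT (fun z => `|(f z)%:E|%E).
    by apply: measurableT_comp => //; exact/measurable_EFinP.
  apply: le_lt_trans ((integrable21ltyP mu mu (measurable_int _ imf)).1 imf).
  apply: ge0_le_integral => //.
  - exact: measurableT_comp.
  - exact: (@measurable_fun_fubini_tonelli_G _ _ _ _ _ mu _ mfE (fun=> abse_ge0 _)).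
  - move=> y _; apply: le_abse_integral => //.
    by apply/measurable_EFinP; exact: L1_measurable.
rewrite /Rintegral.
under eq_integral do rewrite EFin_Rintegral//.
under [in RHS]eq_integral do rewrite EFin_Rintegral//.
by congr fine; exact: (Fubini imf).
Qed.

Lemma Rintegral_Fubini (f : R * R -> R) p q : measurable_fun setT f ->
  L1 p -> L1 q -> (forall x y, `|f (x, y)| <= `|p x| * `|q y|) ->
  \int[mu]_x \int[mu]_y f (x, y) = \int[mu]_y \int[mu]_x f (x, y).
Proof.
move=> mf ip iq fpq.
have iqn := L1_norm iq.
apply: (L1_Rintegral_Fubini (k := fun _ y => `|q y|) mf ip (fun=> iqn) _
  (fun=> lexx _) fpq _).2 => // y.
apply: (@le_L1 _ (fun x => `|q y| * `|p x|)); first exact: measurable_fun_pair1.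
  by move=> x; rewrite mulrC.
exact/L1Zl/L1_norm.
Qed.

Lemma measurable_affine2 (a b c : R) :
  measurable_fun setT (fun z : R * R => a * z.1 + b * z.2 + c).
Proof.
apply: measurable_funD => //; apply: measurable_funD; apply: measurable_funM => //.
Qed.

Lemma measurable_comp_affine2 (a b c : R) p : measurable_fun setT p ->
  measurable_fun setT (fun z : R * R => p (a * z.1 + b * z.2 + c)).
Proof. by move=> mp; apply: measurableT_comp => //; exact: measurable_affine2. Qed.

Lemma measurable_comp_fst p : measurable_fun setT p ->
  measurable_fun setT (fun z : R * R => p z.1).
Proof. by move=> mp; exact: (measurableT_comp mp measurable_fst). Qed.

Lemma measurable_comp_snd p : measurable_fun setT p ->
  measurable_fun setT (fun z : R * R => p z.2).
Proof. by move=> mp; exact: (measurableT_comp mp measurable_snd). Qed.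

End LebesgueFunctions.

(** * The L1 modulus of continuity *)

Section Translation.
Context {R : realType}.
Local Notation mu := (@lebesgue_measure R).
Implicit Types (p q w g k : R -> R).

(** The L1 modulus of continuity: the L1 distance between [q] and its translate by [h]. *)
Definition omega q (h : R) : R := \int[mu]_x `|q (x - h) - q x|.

Lemma L1_shift (h : R) q : L1 q -> L1 (fun x => q (x - h)).
Proof.
move=> iq; apply: (eq_L1 _ (L1_affine (- h) (oner_neq0 R) iq)) => x.
by rewrite mul1r.
Qed.

Lemma Rintegral_shift (h : R) q : L1 q -> \int[mu]_x q (x - h) = \int[mu]_x q x.
Proof.
move=> iq; rewrite [RHS](Rintegral_affine (- h) (oner_neq0 R) iq) normr1 mul1r.
by apply: eq_Rintegral => x _; rewrite mul1r.
Qed.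

Lemma L1_omega (h : R) q : L1 q -> L1 (fun x => `|q (x - h) - q x|).
Proof. by move=> iq; apply/L1_norm/L1B => //; exact: L1_shift. Qed.

Lemma omega_ge0 q h : 0 <= omega q h.
Proof. exact: Rintegral_ge0. Qed.

Lemma omega_le q h : L1 q -> omega q h <= 2 * \int[mu]_x `|q x|.
Proof.
move=> iq; have iqn := L1_norm iq.
rewrite mulr_natl mulr2n -{1}(Rintegral_shift h iqn) -RintegralD//; last exact: (L1_shift _ iqn).
apply: le_Rintegral => //; first exact: L1_omega.
- by apply: L1D => //; exact: (L1_shift h iqn).
- by move=> x _; exact: ler_normB.
Qed.

Lemma omega_triangle k q h : L1 k -> L1 q ->
  omega q h <= omega k h + 2 * \int[mu]_x `|q x - k x|.
Proof.
move=> ik iq; have id := L1_norm (L1B iq ik).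
have i1 := L1_shift h id; have i2 := L1_omega h ik; have i3 := L1D i1 id.
rewrite mulr_natl mulr2n -{1}(Rintegral_shift h id) -!RintegralD//.
apply: le_Rintegral => //; first exact: L1_omega.
- exact: L1D.
- move=> x _; have -> : q (x - h) - q x = (k (x - h) - k x) +
     ((q (x - h) - k (x - h)) - (q x - k x)) by ring.
  by rewrite (le_trans (ler_normD _ _))// lerD2l; exact: ler_normB.
Qed.

(** Reduces to sequences, for dominated convergence, and moreover to sequences in [-1, 1], so that
    the translates of a compactly supported function share one compact support. Finitely many terms
    are replaced by 0 to achieve this. *)
Lemma cvg0_seq (F : R -> R) :
  (forall u : nat -> R, (forall n, `|u n| <= 1) -> u n @[n --> \oo] --> 0 ->
     F (u n) @[n --> \oo] --> 0) -> F h @[h --> 0] --> 0.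
Proof.
move=> H; apply/(@cvg_nbhsP R R^o F 0 0) => u u0.
pose v n := if `|u n| <= 1 then u n else 0.
have uv : \forall n \near \oo, v n = u n.
  have /cvgr0Pnorm_lt /(_ 1 ltr01) := u0; apply: filterS => n un1.
  by rewrite /v (ltW un1).
have v0 : v n @[n --> \oo] --> 0.
  apply: cvg_trans u0; apply: near_eq_cvg.
  by apply: filterS uv => n ->.
have : F (v n) @[n --> \oo] --> 0.
  by apply: H => // n; rewrite /v; case: ifP => //; rewrite normr0.
apply: cvg_trans; apply: near_eq_cvg.
by apply: filterS uv => n ->.
Qed.

Lemma omega_compact_support k (N : R) : continuous k ->
  (forall x, N < `|x| -> k x = 0) -> omega k h @[h --> 0] --> 0.
Proof.
move=> ck k0.
have [N0|N0] := ltP N 0.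
  have kE x : k x = 0 by apply: k0; exact: (lt_le_trans N0).
  rewrite (_ : omega k = fun=> 0); first exact: cvg_cst.
  apply/funext => h; rewrite /omega.
  under eq_Rintegral do rewrite !kE subrr normr0.
  by rewrite Rintegral_cst// mul0r.
have NN : - (N + 1) <= N + 1 by lra.
have [c _ kc] := EVT_max (f := fun x => `|k x|) NN
  (continuous_subspaceT (fun x => continuous_comp (ck x) (@norm_continuous _ _ _))).
have kC x : `|k x| <= `|k c|.
  have [xN|xN] := leP `|x| (N + 1).
    by apply: kc; rewrite in_itv/= -ler_norml.
  by rewrite k0 ?normr0//; lra.
apply: cvg0_seq => u u1 u0.
have -> : 0 = \int[mu]_(x in setT) (0:R) :> R by rewrite Rintegral_cst// mul0r.
pose G x : R := (2 * `|k c|) * \1_`[- (N + 1), N + 1] x.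
have mk : measurable_fun setT k by exact: continuous_measurable_fun.
apply: (@Rintegral_dominated_cvg _ _ _ G).
- move=> n; apply: measurableT_comp => //; apply: measurable_funB => //.
  by apply: measurableT_comp => //; exact: measurable_funB.
- move=> x; rewrite -(normr0 R) -(subrr (k x)); apply: cvg_norm; apply: cvgB; last exact: cvg_cst.
  apply: (continuous_cvg _ (ck x)); rewrite -[X in _ --> X]subr0.
  by apply: cvgB => //; exact: cvg_cst.
- apply: L1Zl; exact: (integrable_indic_itv (- (N + 1)) (N + 1) true false).
- move=> n x; rewrite normr_id /G indicE.
  have [/set_mem|/negP xN] := boolP (x \in _).
    by move=> _; rewrite mulr1 (le_trans (ler_normB _ _))// mulr_natl mulr2n lerD.
  have {}xN : N + 1 < `|x|.
    by rewrite ltNge ler_norml; apply/negP => xN'; apply: xN; rewrite inE/= in_itv.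
  rewrite mulr0 !k0 ?subrr ?normr0//; first by lra.
  have := lerB_dist x (u n); have := u1 n; lra.
Qed.

End Translation.

(** * Continuous functions of compact support are dense in L1; translation is continuous in L1 *)

Section Density.
Context {R : realType}.
Local Notation mu := (@lebesgue_measure R).
Implicit Types (p q w g k : R -> R).

Let tent (n : nat) (x : R) : R := Num.max 0 (Num.min 1 (n.+1%:R - `|x|)).

Let tent_cont n : continuous (tent n).
Proof.
move=> x; have c1 : {for x, continuous (fun x : R => n.+1%:R - `|x| : R^o)}.
  by apply: cvgB; [exact: cvg_cst|exact: norm_continuous].
have cc (c : R) : {for x, continuous (fun=> c : R^o)} by exact: cvg_cst.
exact: (continuous_max (cc 0) (continuous_min (cc 1) c1)).
Qed.

Let tent_ge0 n x : 0 <= tent n x.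
Proof. by rewrite /tent le_max lexx. Qed.

Let tent_le1 n x : tent n x <= 1.
Proof. by rewrite /tent ge_max ler01/= ge_min lexx. Qed.

Let tent1 n x : `|x| <= n%:R -> tent n x = 1.
Proof.
move=> xn; rewrite /tent min_l ?max_r//.
by rewrite -natr1 lerBrDl lerD2r.
Qed.

Let tent0 n x : n.+1%:R < `|x| -> tent n x = 0.
Proof. by move=> xn; rewrite /tent max_l// ge_min subr_le0 (ltW xn) orbT. Qed.

(** Approximation by continuous functions is available on a set of finite measure only, with no
    control outside. Multiplying the approximant [g] by the cutoff [tent n] removes the outside, at
    the price of a tail of [q] that is small for [n] large. *)
Lemma dense_compact_support q (e : R) : L1 q -> 0 < e -> exists k (N : R),
  [/\ continuous k, forall x, N < `|x| -> k x = 0, L1 k &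
      \int[mu]_x `|q x - k x| < e].
Proof.
move=> iq e0.
have iqn := L1_norm iq.
have mtent n : measurable_fun setT (tent n) by exact: continuous_measurable_fun.
have tail : \int[mu]_x ((1 - tent n x) * `|q x|) @[n --> \oo] --> 0.
  have -> : 0 = \int[mu]_(x in setT) (0:R) :> R by rewrite Rintegral_cst// mul0r.
  apply: (@Rintegral_dominated_cvg _ _ _ (fun x => `|q x|)) => //.
  - move=> n; apply: measurable_funM; last exact: L1_measurable.
    exact: measurable_funB.
  - move=> x; apply: cvg_near_cst; near=> n.
    rewrite tent1 ?subrr ?mul0r//; near: n.
    exact: nbhs_infty_ger.
  - move=> n x; rewrite normrM normr_id ler_piMl// ger0_norm ?subr_ge0 ?tent_le1//.
    by rewrite gerBl.
have e20 : 0 < e / 2 by rewrite divr_gt0.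
have [n _ /(_ n (leqnn n))] := (cvgr0Pnorm_lt _).1 tail _ e20.
rewrite /= => tn.
pose E : set R := `[- n.+1%:R, n.+1%:R]%classic.
have mE : measurable E by exact: measurable_itv.
have Efin : (mu E < +oo)%E.
  by rewrite /E lebesgue_measure_itv/=; case: ifP => _; rewrite ?ltry.
have iqE : mu.-integrable E (EFin \o q) by exact: integrableS iq.
have [g_ [cg ig]] := approximation_continuous_integrable mE Efin iqE.
move/fine_cvgP => [_ /cvgr0Pnorm_lt /(_ _ e20) [m _ /(_ m (leqnn m))]].
set g := g_ m in cg ig *.
rewrite /= => gm.
pose h (x : R) : R := `|q x - g x|.
have ihE : mu.-integrable E (EFin \o h).
  have iB : mu.-integrable E (fun x => (q x)%:E - (g x)%:E)%E by apply: integrableB => //; exact: ig.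
  exact: (@integrable_norm _ (measurableTypeR R) _ mu E (fun x => q x - g x) iB).
have ih : L1 (h \_ E) by rewrite /L1 -restrict_EFin; exact: ((@integrable_mkcond _ (measurableTypeR R) _ mu E _ mE).1 ihE).
have it : L1 (fun x => (1 - tent n x) * `|q x|).
  apply: L1_bmM => //; split; first exact: measurable_funB.
  by exists 1 => x; rewrite ger0_norm ?subr_ge0 ?tent_le1// gerBl.
have le_h x : `|q x - tent n x * g x| <= (1 - tent n x) * `|q x| + (h \_ E) x.
  rewrite patchE; case: ifPn => [_|/negP xE].
    (* Splits the error into the tail of [q], where the cutoff is below 1, and the error of
       approximation on [E], where the cutoff can be nonzero. *)
    have -> : q x - tent n x * g x = (1 - tent n x) * q x + tent n x * (q x - g x) by ring.
    rewrite (le_trans (ler_normD _ _))// !normrM [`|1 - _|]ger0_norm ?subr_ge0 ?tent_le1//.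
    by rewrite lerD2l ler_piMl// ger0_norm ?tent_le1.
  rewrite tent0 ?mul0r ?subr0 ?mul1r ?addr0//.
  by rewrite ltNge; apply/negP; rewrite ler_norml => xE'; apply: xE; apply/mem_set; rewrite /E/= in_itv.
have mg : measurable_fun setT g by apply: continuous_measurable_fun; exact: cg.
have mk : measurable_fun setT (fun x => tent n x * g x) by exact: measurable_funM.
have id : L1 (fun x => q x - tent n x * g x).
  apply: (le_L1 _ le_h); last exact: L1D.
  by apply: measurable_funB => //; exact: L1_measurable.
exists (fun x => tent n x * g x), n.+1%:R; split.
- by move=> x; apply: cvgM; [exact: tent_cont|exact: cg].
- by move=> x xn; rewrite tent0// mul0r.
- by apply: (eq_L1 _ (L1B iq id)) => x; rewrite opprB addrC subrK.
- apply: (@le_lt_trans _ _ (\int[mu]_x ((1 - tent n x) * `|q x| + (h \_ E) x))).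
    by apply: le_Rintegral => //; [exact: L1_norm|exact: L1D].
  rewrite RintegralD// -Rintegral_mkcond [ltRHS]splitr ltrD//.
    by apply: le_lt_trans tn; exact: ler_norm.
  by apply: le_lt_trans gm; exact: ler_norm.
Unshelve. all: end_near. Qed.

Lemma omega_cvg0 q : L1 q -> omega q h @[h --> 0] --> 0.
Proof.
move=> iq; apply/cvgr0Pnorm_lt => e e0.
have e4 : 0 < e / 4 by rewrite divr_gt0.
have [k [N [ck kN ik qk]]] := dense_compact_support iq e4.
have /cvgr0Pnorm_lt /(_ _ e4) := omega_compact_support ck kN.
apply: filterS => h; rewrite !ger0_norm ?omega_ge0// => kh.
by apply: (le_lt_trans (omega_triangle h ik iq)); lra.
Qed.

End Density.

(** * Convolution of a bounded function with an integrable one *)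

Section Convolution.
Context {R : realType}.
Local Notation mu := (@lebesgue_measure R).
Implicit Types (p q w g v : R -> R).

Definition convol g p (y : R) : R := \int[mu]_s (g (y - s) * p s).

Lemma bm_comp_affine (a b : R) g : bounded_meas g -> bounded_meas (fun x => g (a * x + b)).
Proof. by move=> [mg [M gM]]; split; [exact: measurable_comp_affine|exists M]. Qed.

Lemma bm_rev (y : R) g : bounded_meas g -> bounded_meas (fun s => g (y - s)).
Proof.
move=> bg; have := bm_comp_affine (-1) y bg.
by congr bounded_meas; apply/funext => s; congr g; ring.
Qed.

Lemma bm_cst (c : R) : bounded_meas (fun=> c).
Proof. by split=> //; exists `|c|. Qed.

Lemma bmD g w : bounded_meas g -> bounded_meas w -> bounded_meas (fun x => g x + w x).
Proof.
move=> [mg [M gM]] [mw [N wN]]; split; first exact: measurable_funD.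
by exists (M + N) => x; rewrite (le_trans (ler_normD _ _))// lerD.
Qed.

Lemma bmM g w : bounded_meas g -> bounded_meas w -> bounded_meas (fun x => g x * w x).
Proof.
move=> [mg [M gM]] [mw [N wN]]; split; first exact: measurable_funM.
by exists (M * N) => x; rewrite normrM ler_pM.
Qed.

Lemma bmB g w : bounded_meas g -> bounded_meas w -> bounded_meas (fun x => g x - w x).
Proof.
move=> bg bw; have := bmD bg (bmM (bm_cst (-1)) bw).
by congr bounded_meas; apply/funext => s; ring.
Qed.

Lemma measurable_cos : measurable_fun setT (@cos R).
Proof. by apply: continuous_measurable_fun; exact: continuous_cos. Qed.

Lemma measurable_sin : measurable_fun setT (@sin R).
Proof. by apply: continuous_measurable_fun; exact: continuous_sin. Qed.

Lemma bm_cos (a : R) : bounded_meas (fun x => cos (a * x)).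
Proof.
split; last by exists 1 => x; exact: cos_max.
by apply: measurableT_comp; [exact: measurable_cos|exact: mulrl_measurable].
Qed.

Lemma bm_sin (a : R) : bounded_meas (fun x => sin (a * x)).
Proof.
split; last by exists 1 => x; exact: sin_max.
by apply: measurableT_comp; [exact: measurable_sin|exact: mulrl_measurable].
Qed.

Lemma conv_L1 g p y : bounded_meas g -> L1 p -> L1 (fun s => g (y - s) * p s).
Proof. by move=> bg ip; apply: L1_bmM => //; exact: bm_rev. Qed.

Lemma L1_rev (y : R) p : L1 p -> L1 (fun s => p (y - s)).
Proof.
have N1 : -1 != 0 :> R by rewrite oppr_eq0 oner_eq0.
move=> ip; apply: (eq_L1 _ (L1_affine y N1 ip)) => s.
by congr p; ring.
Qed.

Lemma Rintegral_rev (y : R) p : L1 p -> \int[mu]_s p (y - s) = \int[mu]_s p s.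
Proof.
have N1 : -1 != 0 :> R by rewrite oppr_eq0 oner_eq0.
move=> ip; rewrite [RHS](Rintegral_affine y N1 ip) normrN1 mul1r.
by apply: eq_Rintegral => s _; congr p; ring.
Qed.

Lemma conv_sym g p y : bounded_meas g -> L1 p ->
  convol g p y = \int[mu]_t (g t * p (y - t)).
Proof.
move=> bg ip; rewrite -(Rintegral_rev y); last exact: (L1_bmM bg (L1_rev y ip)).
by apply: eq_Rintegral => s _; rewrite subKr.
Qed.

Lemma conv_le (M : R) g p y : bounded_meas g -> L1 p -> (forall x, `|g x| <= M) ->
  `|convol g p y| <= M * \int[mu]_s `|p s|.
Proof.
move=> bg ip gM; have ipn := L1_norm ip.
rewrite -(RintegralZl M measurableT ipn); apply: norm_Rintegral_le.
- exact: conv_L1.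
- exact: L1Zl.
- by move=> x; rewrite normrM ler_wpM2r.
Qed.

Lemma convDl g w p y : bounded_meas g -> bounded_meas w -> L1 p ->
  convol (fun x => g x + w x) p y = convol g p y + convol w p y.
Proof.
move=> bg bw ip; rewrite /convol -(RintegralD measurableT (conv_L1 y bg ip) (conv_L1 y bw ip)).
by apply: eq_Rintegral => s _; rewrite mulrDl.
Qed.

Lemma convDr g p q y : bounded_meas g -> L1 p -> L1 q ->
  convol g (fun x => p x + q x) y = convol g p y + convol g q y.
Proof.
move=> bg ip iq; rewrite /convol -(RintegralD measurableT (conv_L1 y bg ip) (conv_L1 y bg iq)).
by apply: eq_Rintegral => s _; rewrite mulrDr.
Qed.

Lemma convZr (c : R) g p y : bounded_meas g -> L1 p ->
  convol g (fun x => c * p x) y = c * convol g p y.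
Proof.
move=> bg ip; rewrite /convol -(RintegralZl c measurableT (conv_L1 y bg ip)).
by apply: eq_Rintegral => s _; rewrite mulrCA.
Qed.

Lemma convBr g p q y : bounded_meas g -> L1 p -> L1 q ->
  convol g (fun x => p x - q x) y = convol g p y - convol g q y.
Proof.
move=> bg ip iq; rewrite /convol -(RintegralB measurableT (conv_L1 y bg ip) (conv_L1 y bg iq)).
by apply: eq_Rintegral => s _; rewrite mulrBr.
Qed.

Lemma convBl g w p y : bounded_meas g -> bounded_meas w -> L1 p ->
  convol (fun x => g x - w x) p y = convol g p y - convol w p y.
Proof.
move=> bg bw ip; rewrite /convol -(RintegralB measurableT (conv_L1 y bg ip) (conv_L1 y bw ip)).
by apply: eq_Rintegral => s _; rewrite mulrBl.
Qed.

Lemma conv_shift (h : R) g p y : bounded_meas g -> L1 p ->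
  convol g p (y - h) = convol g (fun s => p (s - h)) y.
Proof.
move=> bg ip; rewrite /convol -(Rintegral_shift h (conv_L1 (y - h) bg ip)).
by apply: eq_Rintegral => s _; congr (g _ * _); ring.
Qed.

(** Translating the convolution amounts to translating [p], so its regularity comes from [p] alone,
    and the estimate is uniform in [y]. *)
Lemma conv_modulus (M h : R) g p y : bounded_meas g -> L1 p -> (forall x, `|g x| <= M) ->
  `|convol g p (y - h) - convol g p y| <= M * omega p h.
Proof.
move=> bg ip gM; rewrite conv_shift// -convBr//; last exact: (L1_shift h ip).
by apply: conv_le => //; apply: L1B => //; exact: L1_shift.
Qed.

Lemma conv_continuous g p : bounded_meas g -> L1 p -> continuous (convol g p).
Proof.
move=> bg ip y; have [_ [M gM]] := bg.
have c1 : y - z @[z --> y] --> (0 : R).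
  rewrite -[X in _ --> X](subrr y).
  by apply: (@cvgB _ R^o); [exact: cvg_cst|exact: cvg_id].
have c0 : M * omega p (y - z) @[z --> y] --> 0.
  rewrite -(mulr0 M); apply: cvgM; first exact: cvg_cst.
  apply: (cvg_comp (fun z => y - z) (omega p) _ (omega_cvg0 ip)).
  exact: c1.
apply/cvgrPdist_lt => e e0; have /cvgr0Pnorm_lt /(_ e e0) := c0.
apply: filterS => z; apply: le_lt_trans.
rewrite distrC -[in X in X <= _](subKr y z).
exact: (le_trans (conv_modulus (y - z) y bg ip gM) (ler_norm _)).
Qed.

Lemma conv_bm g p : bounded_meas g -> L1 p -> bounded_meas (convol g p).
Proof.
move=> bg ip; split.
  by apply: continuous_measurable_fun; exact: conv_continuous.
by have [_ [M gM]] := bg; exists (M * \int[mu]_s `|p s|) => x; exact: conv_le.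
Qed.

(** Fubini. Stated as an exchange of two successive convolutions, so that [p] and [w], which are
    merely integrable, are not convolved with each other. *)
Lemma conv_swap g p w y : bounded_meas g -> L1 p -> L1 w ->
  convol (convol g p) w y = convol (convol g w) p y.
Proof.
move=> bg ip iw; have [mg [M gM]] := bg.
transitivity (\int[mu]_u \int[mu]_s (g (y - u - s) * (p s * w u))).
  apply: eq_Rintegral => u _; rewrite -(RintegralZr _ measurableT (conv_L1 (y - u) bg ip)).
  by apply: eq_Rintegral => s _; rewrite mulrA.
(* The bound on [g] is absorbed into [p], which puts the majorant in the product form that Fubini
   requires. *)
have iMp := L1Zl M ip.
rewrite (Rintegral_Fubini (f := fun z => g (y - z.1 - z.2) * (p z.2 * w z.1)) _ iw iMp).
- apply: eq_Rintegral => s _; rewrite -(RintegralZr _ measurableT (conv_L1 (y - s) bg iw)).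
  by apply: eq_Rintegral => u _; rewrite addrAC mulrAC mulrA.
- apply: measurable_funM.
    have := measurable_comp_affine2 (-1) (-1) y mg.
    by congr measurable_fun; apply/funext => z; congr g; ring.
  apply: measurable_funM.
    exact: (measurable_comp_snd (L1_measurable ip)).
  exact: (measurable_comp_fst (L1_measurable iw)).
- move=> u s /=; rewrite !normrM [leRHS]mulrC -mulrA.
  by rewrite ler_wpM2r ?mulr_ge0// (le_trans (gM _))// ler_norm.
Qed.

(** [omega v] is the inner integral of a nonnegative measurable function of two variables, hence
    measurable by Tonelli. *)
Lemma measurable_omega v : L1 v -> measurable_fun setT (omega v).
Proof.
move=> iv; have mv := L1_measurable iv.
have md : measurable_fun setT (fun z : R * R => `|v (z.2 - z.1) - v z.2|%:E).
  apply/measurable_EFinP; apply: measurableT_comp => //; apply: measurable_funB.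
    have := measurable_comp_affine2 (-1) 1 0 mv.
    by congr measurable_fun; apply/funext => z; congr v; ring.
  exact: measurable_comp_snd.
have := @measurable_fun_fubini_tonelli_F _ _ _ _ _ mu _ md (fun=> normr_ge0 _).
have -> : fubini_F mu (fun z : R * R => `|v (z.2 - z.1) - v z.2|%:E) = EFin \o omega v.
  by apply/funext => s; rewrite /= /omega EFin_Rintegral//; exact: L1_omega.
by move/measurable_EFinP.
Qed.

(** The difference is the integral of [p s * (v (u - s) - v u)] in [s]; taking absolute values and
    integrating in [u] first leaves [omega v s]. If [v] hardly changes in L1 under the translations
    that [p] weighs, convolution with [p] acts on [v] nearly as multiplication by the integral of
    [p]. *)
Lemma conv_approx_unit v p : bounded_meas v -> L1 v -> L1 p ->
  L1 (fun u => convol v p u - (\int[mu]_s p s) * v u) /\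
  \int[mu]_u `|convol v p u - (\int[mu]_s p s) * v u| <=
  \int[mu]_s (`|p s| * omega v s).
Proof.
move=> bv iv ip; have [mv [M vM]] := bv.
pose k (s u : R) : R := `|v (u - s) - v u|.
have ik s : L1 (k s) by exact: L1_omega.
have i2 u : L1 (fun s => p s * (v (u - s) - v u)).
  have := L1_bmM (bmB (bm_rev u bv) (bm_cst (v u))) ip.
  by apply: eq_L1 => s; rewrite mulrC.
have md : measurable_fun setT (fun z : R * R => v (z.2 - z.1) - v z.2).
  apply: measurable_funB.
    have := measurable_comp_affine2 (-1) 1 0 mv.
    by congr measurable_fun; apply/funext => z; congr v; ring.
  exact: measurable_comp_snd.
have mp1 : measurable_fun setT (fun z : R * R => p z.1).
  exact: (measurable_comp_fst (L1_measurable ip)).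
have lek s u : `|p s * (v (u - s) - v u)| <= `|p s| * k s u by rewrite normrM.
have [ir _] := L1_Rintegral_Fubini (f := fun z => p z.1 * (v (z.2 - z.1) - v z.2))
  (measurable_funM mp1 md) ip ik (fun s u => normr_ge0 _) (fun s => omega_le s iv)
  lek i2.
have mpn : measurable_fun setT (fun z : R * R => `|p z.1| * `|v (z.2 - z.1) - v z.2|).
  by apply: measurable_funM; exact: measurableT_comp.
have i2n u : L1 (fun s => `|p s| * `|v (u - s) - v u|).
  by apply: (eq_L1 _ (L1_norm (i2 u))) => s; rewrite normrM.
have lepk s u : `| (`|p s| * `|v (u - s) - v u|) | <= `|p s| * k s u.
  by rewrite -normrM normr_id normrM.
have [im Fm] := L1_Rintegral_Fubini
  (f := fun z => `|p z.1| * `|v (z.2 - z.1) - v z.2|)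
  mpn ip ik (fun s u => normr_ge0 _) (fun s => omega_le s iv) lepk i2n.
have rE u : convol v p u - (\int[mu]_s p s) * v u = \int[mu]_s (p s * (v (u - s) - v u)).
  have i3 : L1 (fun s => p s * v u) by apply: (eq_L1 _ (L1Zl (v u) ip)) => s; rewrite mulrC.
  rewrite -(RintegralZr _ measurableT ip) -(RintegralB measurableT (conv_L1 u bv ip) i3).
  by apply: eq_Rintegral => s _; ring.
split.
- by apply: (eq_L1 _ ir) => u; rewrite rE.
- have -> : \int[mu]_s (`|p s| * omega v s) =
     \int[mu]_u \int[mu]_s (`|p s| * `|v (u - s) - v u|).
    rewrite -Fm; apply: eq_Rintegral => s _.
    exact: (esym (RintegralZl _ measurableT (ik s))).
  apply: le_Rintegral => //.
  + by apply: L1_norm; apply: (eq_L1 _ ir) => u; rewrite rE.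
  + move=> u _; rewrite rE; apply: norm_Rintegral_le => // s; rewrite normrM.
Qed.

Lemma conv_assoc g v p y : bounded_meas g -> bounded_meas v -> L1 v -> L1 p ->
  convol (convol g v) p y = convol g (convol v p) y.
Proof.
move=> bg bv iv ip; have [mg [M gM]] := bg.
have mv := L1_measurable iv; have mp := L1_measurable ip.
transitivity (\int[mu]_s \int[mu]_t (g (y - t) * (v (t - s) * p s))).
  apply: eq_Rintegral => s _; rewrite conv_shift//.
  rewrite -(RintegralZr _ measurableT (conv_L1 y bg (L1_shift s iv))).
  by apply: eq_Rintegral => t _; rewrite mulrA.
have iMp := L1Zl M ip.
rewrite (L1_Rintegral_Fubini (f := fun z => g (y - z.2) * (v (z.2 - z.1) * p z.1))
  (k := fun s t => `|v (t - s)|) (C := \int[mu]_t `|v t|) _ iMp _ _ _ _ _).2.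
- by apply: eq_Rintegral => t _ /=; exact: (RintegralZl _ measurableT (conv_L1 t bv ip)).
- apply: measurable_funM; last apply: measurable_funM.
  + have := measurable_comp_affine2 0 (-1) y mg.
    by congr measurable_fun; apply/funext => z; congr g; ring.
  + have := measurable_comp_affine2 (-1) 1 0 mv.
    by congr measurable_fun; apply/funext => z; congr v; ring.
  + exact: (measurable_comp_fst (L1_measurable ip)).
- by move=> s; exact/L1_norm/L1_shift.
- by [].
- by move=> s; rewrite (Rintegral_shift s (L1_norm iv)).
- move=> s t /=; rewrite !normrM [`|v _| * _]mulrC mulrA.
  by rewrite !ler_wpM2r// (le_trans (gM _))// ler_norm.
- by move=> t /=; apply: L1Zl; exact: conv_L1.
Qed.

(** Dominated convergence along sequences: for fixed [s], the point [y - s] tends to infinity with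
    [y]. *)
Lemma conv_cvg0 g p : bounded_meas g -> L1 p ->
  g x @[x --> +oo] --> 0 -> convol g p y @[y --> +oo] --> 0.
Proof.
move=> bg ip g0; have [mg [M gM]] := bg.
apply/cvg_pinftyP => u uy.
have -> : 0 = \int[mu]_(x in setT) (0:R) :> R by rewrite Rintegral_cst// mul0r.
apply: (@Rintegral_dominated_cvg _ _ _ (fun s => M * `|p s|)).
- by move=> n; exact: (L1_measurable (conv_L1 (u n) bg ip)).
- move=> s; rewrite -(mul0r (p s)); apply: cvgM; last exact: cvg_cst.
  have /cvg_pinftyP := g0; apply.
  apply/cvgryPge => A; have /cvgryPge /(_ (A + s)) := uy.
  by apply: filterS => n; rewrite lerBrDr.
- exact/L1Zl/L1_norm.
- by move=> n x; rewrite normrM ler_wpM2r.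
Qed.

End Convolution.

(** * The Fejer kernel on the line and its approximation by Fejer sums *)

Section FejerKernel.
Context {R : realType}.
Local Notation mu := (@lebesgue_measure R).
Implicit Types (a x t u : R).

Lemma norm_sin_le x : `|sin x| <= `|x|.
Proof.
wlog x0 : x / 0 <= x => [H|].
  have [xp|xN] := leP 0 x; first exact: (H x xp).
  by have := H (- x); rewrite sinN !normrN; apply; lra.
have [c _] := MVT_segment x0 (fun c _ => is_derive_sin c)
  (continuous_subspaceT (@continuous_sin R)).
rewrite sin0 !subr0 => ->; rewrite normrM ler_piMl//; exact: cos_max.
Qed.

Lemma sqr_sin_le x : sin x ^+ 2 <= x ^+ 2.
Proof.
rewrite -[leLHS]real_normK ?num_real// -[leRHS]real_normK ?num_real//.
by rewrite ler_pXn2r ?nnegrE ?norm_sin_le.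
Qed.

Lemma oneBcos x : 1 - cos x = 2 * sin (x / 2) ^+ 2.
Proof.
have {1}-> : x = (x / 2) *+ 2 by rewrite -mulr_natr; field.
by rewrite cos_mulr2n cos2sin2 -mulr_natr; ring.
Qed.

(* The value at [0] is the continuous extension: the junk value [x / 0 = 0] would make
   [conv_fejer_vallee_poussin] fail at [0]. *)
Definition fejer_kernel a t : R :=
  if t == 0 then a ^+ 2 / 2 else (1 - cos (a * t)) / t ^+ 2.

Local Notation K := fejer_kernel.

Lemma fejer_kernelM a t : K a t * t ^+ 2 = 1 - cos (a * t).
Proof.
rewrite /K; case: eqVneq => [->|t0]; last by rewrite divfK ?sqrf_eq0.
by rewrite expr0n mulr0 mulr0 cos0 subrr.
Qed.

Lemma fejer_kernel_ge0 a t : 0 <= K a t.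
Proof.
rewrite /K; case: ifP => _; apply: divr_ge0; rewrite ?sqr_ge0//.
Qed.

Lemma fejer_kernel_le a t : K a t <= a ^+ 2 / 2.
Proof.
rewrite /K; case: eqVneq => [//|t0].
rewrite ler_pdivrMr ?exprn_even_gt0// oneBcos.
have := sqr_sin_le (a * t / 2).
rewrite !exprMn; lra.
Qed.

(** Adds the bound near 0, [K a t <= a ^+ 2 / 2], to the bound at infinity,
    [K a t * t ^+ 2 <= 2]. *)
Lemma fejer_kernel_le_oneDsqr a t : K a t <= (a ^+ 2 / 2 + 2) * (oneDsqr t)^-1.
Proof.
rewrite ler_pdivlMr ?oneDsqr_gt0// /oneDsqr mulrDr mulr1 fejer_kernelM.
have := fejer_kernel_le a t; have := cos_geN1 (a * t); lra.
Qed.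

(** The Dirichlet kernel, the sum of [e^{ijx}] over [|j| <= n]. Below, [fejer_sum n] adds the first
    [n] of these and is the Fejer kernel without its factor [1/n], that is (1 - cos nx) / (1 - cos
    x). Written as sums of cosines, they need no convention where [cos x = 1]. *)
Fixpoint dirichlet_sum (n : nat) x : R :=
  if n is m.+1 then dirichlet_sum m x + 2 * cos (n%:R * x) else 1.

Fixpoint fejer_sum (n : nat) x : R :=
  if n is m.+1 then fejer_sum m x + dirichlet_sum m x else 0.

Lemma dirichlet_sumM n x :
  dirichlet_sum n x * (1 - cos x) = cos (n%:R * x) - cos (n.+1%:R * x).
Proof.
elim: n => [|n IHn] /=; first by rewrite mul0r cos0 !mul1r.
rewrite mulrDl IHn.
have -> : cos (n%:R * x) = cos (n.+1%:R * x) * cos x + sin (n.+1%:R * x) * sin x.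
  by rewrite -cosB; congr cos; rewrite -[n.+1%:R]natr1; ring.
have -> : cos (n.+2%:R * x) = cos (n.+1%:R * x) * cos x - sin (n.+1%:R * x) * sin x.
  by rewrite -cosD; congr cos; rewrite -[n.+2%:R]natr1; ring.
by ring.
Qed.

Lemma fejer_sumM n x : fejer_sum n x * (1 - cos x) = 1 - cos (n%:R * x).
Proof.
elim: n => [|n IHn] /=; first by rewrite !mul0r cos0 subrr.
by rewrite mulrDl IHn dirichlet_sumM; ring.
Qed.

Lemma norm_dirichlet_sum_le n x : `|dirichlet_sum n x| <= 2 * n%:R + 1.
Proof.
elim: n => [|n IHn]; first by rewrite /= mulr0 add0r normr1.
rewrite [dirichlet_sum _ _]/= -natr1 (le_trans (ler_normD _ _))//.
have := cos_max (n.+1%:R * x); rewrite normrM (ger0_norm (ler0n _ 2)) -natr1.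
by move: IHn; lra.
Qed.

Lemma norm_fejer_sum_le n x : `|fejer_sum n x| <= n%:R ^+ 2.
Proof.
elim: n => [|n IHn]; first by rewrite /= normr0 sqr_ge0.
rewrite [fejer_sum _ _]/= (le_trans (ler_normD _ _))// -natr1.
by have := norm_dirichlet_sum_le n x; move: IHn; lra.
Qed.

Lemma fejer_sum0 n : fejer_sum n 0 = n%:R ^+ 2.
Proof.
have D0 m : dirichlet_sum m 0 = 2 * m%:R + 1.
  elim: m => [|m IHm]; first by rewrite /=; ring.
  by rewrite [dirichlet_sum _ _]/= IHm mulr0 cos0 -natr1; ring.
elim: n => [|n IHn]; first by rewrite /= expr0n.
by rewrite [fejer_sum _ _]/= IHn D0 -natr1; ring.
Qed.

(** A property stable under linear combinations passes from cosines to Fejer sums. Only frequencies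
    [j * x] with [j < n] occur; this bound keeps them within the band in both applications. [0 < n]
    excludes the empty sum, for which no cosine is available to start from. *)
Lemma fejer_sum_ind (P : (R -> R) -> Prop) n x :
  (forall h1 h2, P h1 -> P h2 -> P (fun t => h1 t + h2 t)) ->
  (forall k h, P h -> P (fun t => k * h t)) ->
  (forall j, (j < n)%N -> P (fun t => cos (j%:R * (x * t)))) ->
  (0 < n)%N -> P (fun t => fejer_sum n (x * t)).
Proof.
move=> PD PZ Pc.
have PD' m : (m < n)%N -> P (fun t => dirichlet_sum m (x * t)).
  elim: m => [n0|m IHm mn].
    have := Pc 0%N n0; congr P; apply/funext => t; by rewrite mul0r cos0.
  by apply: PD; [exact/IHm/ltnW|apply/PZ/Pc].
elim: n {-2}n (leqnn n) Pc PD' => [n|m IHm [//|n]]; first by rewrite leqn0 => /eqP ->.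
rewrite ltnS => nm Pc PD' _.
have [->|n0] := posnP n.
  have := PD' 0%N isT; congr P; apply/funext => t; by rewrite /= add0r.
apply: PD; last exact: PD'.
by apply: IHm => // j jn; [apply: Pc|apply: PD']; exact: ltnW.
Qed.

Lemma fejer_sum_continuous n : continuous (fejer_sum n).
Proof.
have cc k : continuous (fun x : R => cos (k * x)).
  move=> x; apply: (@continuous_comp _ _ _ ( *%R k) cos); last exact: continuous_cos.
  exact: mulrl_continuous.
have cd m : continuous (dirichlet_sum m).
  elim: m => [|m IHm] x; first exact: cvg_cst.
  by apply: cvgD; [exact: IHm|apply: cvgM; [exact: cvg_cst|exact: cc]].
elim: n => [|n IHn] x; first exact: cvg_cst.
by apply: cvgD; [exact: IHn|exact: cd].
Qed.

(** From [|sin x - x| <= |x| ^ 3 / 2], itself a consequence of the mean value theorem and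
    [1 - cos c <= c ^ 2 / 2]. With [N = n + 1] the error is at most [B / N ^ 2], and [B / N] is
    enough. *)
Lemma cvg_mul_sin_div (k : R) : n.+1%:R * sin (k / n.+1%:R) @[n --> \oo] --> k.
Proof.
pose B : R := `|k| * k ^+ 2 / 2.
have sq x : `|sin x - x| <= `|x| * (x ^+ 2 / 2).
  wlog x0 : x / 0 <= x => [H|].
    have [xp|] := boolP (0 <= x); first exact: (H x xp).
    rewrite -ltNge => xN; have := H (- x); rewrite sinN -opprD !normrN sqrrN; apply; lra.
  have [c] := MVT_segment x0 (fun c _ => is_derive_sin c)
    (continuous_subspaceT (@continuous_sin R)).
  rewrite in_itv/= => /andP[c0 cx]; rewrite sin0 !subr0 => ->.
  have -> : cos c * x - x = - (x * (1 - cos c)) by ring.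
  rewrite normrN normrM ler_wpM2l// ger0_norm ?subr_ge0 ?cos_le1// oneBcos.
  have := sqr_sin_le (c / 2).
  have : c ^+ 2 <= x ^+ 2 by rewrite ler_pXn2r// nnegrE.
  rewrite !exprMn; lra.
have h0 : B * harmonic n @[n --> \oo] --> 0.
  by rewrite -(mulr0 B); apply: cvgM; [exact: cvg_cst|exact: cvg_harmonic].
have hB n : `|n.+1%:R * sin (k / n.+1%:R) - k| <= B * harmonic n.
  have n0 : 0 < n.+1%:R :> R by rewrite ltr0n.
  have -> : n.+1%:R * sin (k / n.+1%:R) - k = n.+1%:R * (sin (k / n.+1%:R) - k / n.+1%:R).
    by field; rewrite gt_eqF.
  rewrite normrM gtr0_norm//.
  apply: (@le_trans _ _ (n.+1%:R * (`|k / n.+1%:R| * ((k / n.+1%:R) ^+ 2 / 2)))).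
    by rewrite ler_pM2l.
  rewrite normrM (gtr0_norm (x := n.+1%:R^-1)) ?invr_gt0//.
  have -> : n.+1%:R * (`|k| * n.+1%:R^-1 * ((k / n.+1%:R) ^+ 2 / 2)) =
    B * harmonic n * n.+1%:R^-1.
    have -> : harmonic n = n.+1%:R^-1 :> R by [].
    by rewrite /B; field; rewrite gt_eqF.
  rewrite ler_piMr// ?invf_le1 ?ler1n// mulr_ge0 ?invr_ge0// /B.
  by rewrite divr_ge0// mulr_ge0 ?sqr_ge0.
apply/cvgrPdist_lt => e e0; have /cvgr0Pnorm_lt /(_ e e0) := h0.
apply: filterS => n; rewrite distrC; apply: le_lt_trans.
exact: (le_trans (hB n) (ler_norm _)).
Qed.

(** With [N = n + 1], the Fejer sum at [a t / N] is (1 - cos(a t)) / (1 - cos(a t / N)): the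
    numerator does not depend on [N], and [N ^ 2] times the denominator tends to [(a t) ^ 2 / 2].
    The normalisation makes all terms equal to the limit at [t = 0]. *)
Lemma cvg_fejer_sum a t :
  a ^+ 2 / 2 / n.+1%:R ^+ 2 * fejer_sum n.+1 (a / n.+1%:R * t) @[n --> \oo] --> K a t.
Proof.
have n0 n : n.+1%:R != 0 :> R by rewrite pnatr_eq0.
have [t0|t0] := eqVneq t 0.
  apply: cvg_near_cst; apply: nearW => n.
  by rewrite t0 mulr0 fejer_sum0 /K eqxx divfK// sqrf_eq0.
have [a0|a0] := eqVneq a 0.
  apply: cvg_near_cst; apply: nearW => n.
  by rewrite a0 /K (negbTE t0) !(expr0n, mul0r) cos0 subrr mul0r.
(* [N ^ 2 * (1 - cos (a t / N))] in half-angle form, to which the limit of [N * sin (k / N)]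
   applies. *)
pose S n : R := 2 * (n.+1%:R * sin (a * t / 2 / n.+1%:R)) ^+ 2.
have cS : S n @[n --> \oo] --> 2 * (a * t / 2) ^+ 2.
  apply: cvgM; first exact: cvg_cst.
  by apply: (@cvgM _ _ _ _ _ _ (a * t / 2) (a * t / 2)); exact: cvg_mul_sin_div.
have s0 : 2 * (a * t / 2) ^+ 2 != 0.
  by rewrite mulf_eq0 sqrf_eq0 !mulf_eq0 invr_eq0 (negbTE a0) (negbTE t0) pnatr_eq0.
have -> : K a t = (a ^+ 2 / 2) * (1 - cos (a * t)) / (2 * (a * t / 2) ^+ 2).
  by rewrite /K (negbTE t0); field; rewrite a0 t0.
have : (a ^+ 2 / 2) * (1 - cos (a * t)) / S n @[n --> \oo] -->
    (a ^+ 2 / 2) * (1 - cos (a * t)) / (2 * (a * t / 2) ^+ 2).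
  by apply: cvgM; [exact: cvg_cst|exact: cvgV].
apply: cvg_trans; apply: near_eq_cvg.
(* The denominator may vanish for small [n]; it is eventually nonzero because its limit is. *)
have /cvgr_neq0 /(_ s0) := cS; apply: filterS => n Sn0.
have SE : S n = n.+1%:R ^+ 2 * (1 - cos (a / n.+1%:R * t)).
  rewrite /S oneBcos exprMn; have -> : a / n.+1%:R * t / 2 = a * t / 2 / n.+1%:R by rewrite (mulrAC a) [LHS]mulrAC.
  by ring.
have c0 : 1 - cos (a / n.+1%:R * t) != 0.
  by move: Sn0; rewrite SE mulf_eq0 negb_or => /andP[].
have := fejer_sumM n.+1 (a / n.+1%:R * t).
have -> : n.+1%:R * (a / n.+1%:R * t) = a * t by rewrite mulrA mulrCA divff ?n0// mulr1.
rewrite SE => <-; move: c0 (n0 n); move: (n.+1%:R : R) => N c0 N0.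
by field; rewrite c0 N0.
Qed.

Lemma measurable_fejer_kernel a : measurable_fun setT (K a).
Proof.
apply: (measurable_fun_cvg (h := fun n t =>
  a ^+ 2 / 2 / n.+1%:R ^+ 2 * fejer_sum n.+1 (a / n.+1%:R * t))) => //.
  move=> n; apply: measurable_funM => //.
  apply: measurableT_comp; last exact: mulrl_measurable.
  by apply: continuous_measurable_fun; exact: fejer_sum_continuous.
by move=> t _; exact: cvg_fejer_sum.
Qed.

Lemma L1_oneDsqrV : L1 (fun t => (oneDsqr t)^-1).
Proof.
have oD0 t : 0 <= (oneDsqr t)^-1 :> R by rewrite invr_ge0 (le_trans _ (oneDsqr_ge1 t)).
apply: L1P.
  by apply: continuous_measurable_fun; exact: continuous_oneDsqrV.
under eq_integral do rewrite ger0_norm//.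
rewrite (ge0_symfun_integralT (f := fun t => (oneDsqr t)^-1))//.
- rewrite (_ : [set x | _] = `[0, +oo[%classic); last first.
    by apply/seteqP; split => x/=; rewrite in_itv/= andbT.
  by rewrite integral0y_oneDsqr -EFinM ltry.
- exact: continuous_oneDsqrV.
- by move=> x /=; rewrite /oneDsqr sqrrN.
Qed.

Lemma L1_fejer_kernel a : L1 (K a).
Proof.
apply: (le_L1 (measurable_fejer_kernel a)); last exact: (L1Zl (a ^+ 2 / 2 + 2) L1_oneDsqrV).
by move=> t; rewrite ger0_norm ?fejer_kernel_ge0// fejer_kernel_le_oneDsqr.
Qed.

Lemma bm_fejer_kernel a : bounded_meas (K a).
Proof.
split; first exact: measurable_fejer_kernel.
by exists (a ^+ 2 / 2) => t; rewrite ger0_norm ?fejer_kernel_ge0// fejer_kernel_le.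
Qed.

(** Classically the number pi. It is kept as a symbol, and [fejer_mass_gt0] provides what dividing
    by it requires. *)
Definition fejer_mass : R := \int[mu]_t K 1 t.
Local Notation c := fejer_mass.

Lemma fejer_kernel_scale a t : K a t = a ^+ 2 * K 1 (a * t).
Proof.
have [->|a0] := eqVneq a 0.
  by rewrite expr0n mul0r /K expr0n /= !mul0r cos0 subrr mul0r if_same.
rewrite /K mulf_eq0 (negbTE a0)/= mul1r; case: eqVneq => [_|t0]; first by rewrite expr1n; field.
by field; rewrite a0 t0.
Qed.

(** The factor [a ^+ 2] of the scaling meets [1 / |a|] from the substitution. The resulting absolute
    value produces the triangular and trapezoidal transforms below. *)
Lemma Rintegral_fejer_kernel a : \int[mu]_t K a t = c * `|a|.
Proof.
have [->|a0] := eqVneq a 0.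
  under eq_Rintegral do rewrite fejer_kernel_scale expr0n mul0r.
  by rewrite Rintegral_cst// mul0r normr0 mulr0.
rewrite /c (Rintegral_affine 0 a0 (L1_fejer_kernel 1)).
under eq_Rintegral do rewrite fejer_kernel_scale.
have iK : L1 (fun t => K 1 (a * t)).
  by apply: (eq_L1 _ (L1_affine 0 a0 (L1_fejer_kernel 1))) => t; rewrite addr0.
rewrite (RintegralZl _ measurableT iK).
under [in RHS]eq_Rintegral do rewrite addr0.
by rewrite [RHS]mulrAC -expr2 real_normK ?num_real.
Qed.

Lemma fejer_mass_gt0 : 0 < c.
Proof.
have c1 : cos 1 < 1 :> R.
  rewrite -{2}(@cos0 R) ltr_cos ?in_itv/= ?lexx ?pi_ge0//.
  by rewrite ler01 (le_trans _ (pi_ge2 R))// ler1n.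
have m0 : 0 < (1 - cos 1) / 4 :> R by rewrite divr_gt0// subr_gt0.
(* A minorant of the kernel: on [1, 2], which lies in [0, pi] where cosine decreases,
   [1 - cos x >= 1 - cos 1], and [x ^+ 2 <= 4]. *)
pose h x : R := ((1 - cos 1) / 4) * \1_`[1, 2] x.
have ih : L1 h by apply: L1Zl; exact: (integrable_indic_itv 1 2 true false).
apply: (@lt_le_trans _ _ (\int[mu]_x h x)).
  rewrite (RintegralZl _ measurableT); last exact: (integrable_indic_itv 1 2 true false).
  rewrite mulr_gt0// /Rintegral integral_indic//= setIT.
  by rewrite lebesgue_measure_itv/= lte_fin ltr1n/= subr_gt0 ltr1n.
apply: le_Rintegral => //; first exact: L1_fejer_kernel.
move=> x _; rewrite /h indicE; case: (boolP (x \in _)) => [/set_mem|_]; last by rewrite mulr0 fejer_kernel_ge0.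
rewrite /= in_itv/= mulr1 => /andP[x1 x2].
have x0 : 0 < x by rewrite (lt_le_trans ltr01).
rewrite /K (gt_eqF x0) mul1r ler_pdivlMr ?exprn_gt0//.
have cx : cos x <= cos 1.
  rewrite leNgt ltr_cos ?in_itv/= -?leNgt// ?ler01 ?(ltW x0)/=.
    exact: (le_trans x2 (pi_ge2 R)).
  by rewrite (le_trans _ (pi_ge2 R))// ler1n.
have x4 : x ^+ 2 <= 4 by rewrite expr2; nra.
by have : cos x <= 1 := cos_le1 x; nra.
Qed.

End FejerKernel.

(** * The de la Vallee Poussin kernel as a reproducing kernel for low frequencies *)

Section ValleePoussin.
Context {R : realType}.
Local Notation mu := (@lebesgue_measure R).
Local Notation K := (@fejer_kernel R).
Local Notation c := (@fejer_mass R).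
Implicit Types (a e t u x : R).

(* Its Fourier transform is the trapezoid equal to [1] on [[-e, e]] and to [0] outside
   [[-2e, 2e]]. *)
Definition vallee_poussin e u : R := (c * e)^-1 * (K (2 * e) u - K e u).
Local Notation V := vallee_poussin.

Lemma L1_vallee_poussin e : L1 (V e).
Proof. by apply/L1Zl/L1B; exact: L1_fejer_kernel. Qed.

Lemma bm_vallee_poussin e : bounded_meas (V e).
Proof. by apply: bmM; [exact: bm_cst|apply: bmB; exact: bm_fejer_kernel]. Qed.

Lemma vallee_poussin_scale e u : e != 0 -> V e u = e * V 1 (e * u).
Proof.
move=> e0; rewrite /V (fejer_kernel_scale (2 * e)) (fejer_kernel_scale e).
rewrite (fejer_kernel_scale (2 * 1)) !mulr1 -mulrA.
have c0 := gt_eqF (@fejer_mass_gt0 R).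
by rewrite exprMn; field; rewrite e0 c0.
Qed.

(** Since [V e] is an L1-normalised dilate of [V 1], a shift by [s] acts on it as a shift by [e * s]
    on [V 1]. As [e] tends to 0 this is negligible for each [s], whence the smallness on which the
    contraction rests. *)
Lemma omega_vallee_poussin e s : 0 < e -> omega (V e) s = omega (V 1) (e * s).
Proof.
move=> e0; have en0 : e != 0 by rewrite gt_eqF.
rewrite /omega (Rintegral_affine 0 en0 (L1_omega (e * s) (L1_vallee_poussin 1))) gtr0_norm//.
have i1 := L1_affine 0 en0 (L1_omega (e * s) (L1_vallee_poussin 1)).
rewrite -(RintegralZl _ measurableT i1).
apply: eq_Rintegral => x _; rewrite !(vallee_poussin_scale _ en0) -mulrBr normrM gtr0_norm//.
by rewrite !addr0 mulrBr.
Qed.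

(** The product formula for cosines writes the integrand as a combination of Fejer kernels with
    parameters [x + a], [x - a] and [x], whose integrals are known; the transform of [K a] on
    [-a, a] is read off from them. *)
Lemma Rintegral_cos_fejer_kernel a x : `|x| <= a ->
  \int[mu]_u (cos (x * u) * K a u) = c * (a - `|x|).
Proof.
move=> xa.
have E u : cos (x * u) * K a u = 2^-1 * K (x + a) u + 2^-1 * K (x - a) u - K x u.
  rewrite /K; case: eqVneq => [->|u0].
    by rewrite mulr0 cos0; field.
  have -> : (x + a) * u = x * u + a * u by ring.
  have -> : (x - a) * u = x * u - a * u by ring.
  rewrite cosD cosB; move: (cos (x * u)) (cos (a * u)) => X Y.
  by field; rewrite u0.
under eq_Rintegral do rewrite E.
have i a' : L1 (fun t => 2^-1 * K a' t) by exact/L1Zl/L1_fejer_kernel.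
rewrite (RintegralB measurableT (L1D (i _) (i _)) (L1_fejer_kernel x)).
rewrite (RintegralD measurableT (i _) (i _)).
rewrite !(RintegralZl _ measurableT (L1_fejer_kernel _)) !Rintegral_fejer_kernel.
move: xa; rewrite ler_norml => /andP[x1 x2].
rewrite (ger0_norm (x := x + a)); last lra.
rewrite (ler0_norm (x := x - a)); last lra.
by field.
Qed.

Lemma Rintegral_odd (p : R -> R) : L1 p -> (forall u, p (- u) = - p u) ->
  \int[mu]_u p u = 0.
Proof.
move=> ip podd; have := Rintegral_rev 0 ip.
under eq_Rintegral do rewrite sub0r podd -mulN1r.
rewrite (RintegralZl _ measurableT ip); lra.
Qed.

Lemma fejer_kernelN a u : K a (- u) = K a u.
Proof. by rewrite /K oppr_eq0 sqrrN mulrN cosN. Qed.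

(** The addition formula leaves the cosine and sine integrals of [V e] at frequency [x]. The first
    is [((2 * e - |x|) - (e - |x|)) / e = 1], the second vanishes because [V e] is even. *)
Lemma conv_cos_vallee_poussin e x t : 0 < e -> `|x| <= e ->
  convol (fun t => cos (x * t)) (V e) t = cos (x * t).
Proof.
move=> e0 xe; have iV := L1_vallee_poussin e.
have c0 : c != 0 by rewrite gt_eqF// fejer_mass_gt0.
have ic := L1_bmM (bm_cos x) iV; have isn := L1_bmM (bm_sin x) iV.
have intc : \int[mu]_u (cos (x * u) * V e u) = 1.
  have E u : cos (x * u) * V e u =
      (c * e)^-1 * (cos (x * u) * K (2 * e) u - cos (x * u) * K e u).
    by rewrite /V mulrCA mulrBr.
  under eq_Rintegral do rewrite E.
  have i a : L1 (fun u => cos (x * u) * K a u).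
    by apply: L1_bmM; [exact: bm_cos|exact: L1_fejer_kernel].
  rewrite (RintegralZl _ measurableT (L1B (i _) (i _))) (RintegralB measurableT (i _) (i _)).
  rewrite !Rintegral_cos_fejer_kernel//; last by rewrite (le_trans xe)//; lra.
  by field; rewrite c0 gt_eqF.
have ints : \int[mu]_u (sin (x * u) * V e u) = 0.
  apply: Rintegral_odd => // u.
  by rewrite /V !fejer_kernelN mulrN sinN mulNr.
rewrite /convol.
have E u : cos (x * (t - u)) * V e u =
    cos (x * t) * (cos (x * u) * V e u) + sin (x * t) * (sin (x * u) * V e u).
  by rewrite mulrBr cosB; ring.
under eq_Rintegral do rewrite E.
rewrite (RintegralD measurableT (L1Zl _ ic) (L1Zl _ isn)).
by rewrite (RintegralZl _ measurableT ic) (RintegralZl _ measurableT isn) intc ints mulr1 mulr0 addr0.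
Qed.

(* The Fejer kernel is a limit of Fejer sums, i.e. of combinations of cosines of
   frequency at most [e], each of which is reproduced by [V e]. *)
Lemma conv_fejer_vallee_poussin e a t : 0 < e -> `|a| <= e ->
  convol (K a) (V e) t = K a t.
Proof.
move=> e0 ae; have iV := L1_vallee_poussin e.
pose D n t := a ^+ 2 / 2 / n.+1%:R ^+ 2 * fejer_sum n.+1 (a / n.+1%:R * t).
pose rep (h : R -> R) := bounded_meas h /\ forall t, convol h (V e) t = h t.
have repD n : rep (D n).
  apply: (fejer_sum_ind (P := fun h => rep (fun t => a ^+ 2 / 2 / n.+1%:R ^+ 2 * h t))) => //.
  - move=> h1 h2 [b1 r1] [b2 r2]; split.
      by have := bmD b1 b2; congr bounded_meas; apply/funext => s; rewrite mulrDr.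
    move=> s; rewrite mulrDr -r1 -r2 -convDl//; congr convol.
    by apply/funext => u; rewrite mulrDr.
  - move=> k h [b r]; have E : (fun t => a ^+ 2 / 2 / n.+1%:R ^+ 2 * (k * h t)) =
       (fun t => k * (a ^+ 2 / 2 / n.+1%:R ^+ 2 * h t)) by apply/funext => s; rewrite mulrCA.
    rewrite E; split; first by apply: bmM => //; exact: bm_cst.
    move=> s; rewrite -[in RHS]r /convol -(RintegralZl _ measurableT (conv_L1 s b iV)).
    by apply: eq_Rintegral => u _; exact: (esym (mulrA _ _ _)).
  - move=> j jn.
    have E : (fun t => cos (j%:R * (a / n.+1%:R * t))) = (fun t => cos ((j%:R * (a / n.+1%:R)) * t)).
      by apply/funext => s; rewrite mulrA.
    split.
      by apply: bmM; [exact: bm_cst|rewrite E; exact: bm_cos].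
    (* The frequencies are [j * a / (n + 1)] with [j < n + 1], so they do not exceed [|a|]. *)
    move=> s; have ja : `|j%:R * (a / n.+1%:R)| <= e.
      rewrite (le_trans _ ae)// !normrM mulrCA ler_piMr// normfV !normr_nat.
      by rewrite ler_pdivrMr ?ltr0n// mul1r ler_nat ltnW.
    rewrite [in RHS]mulrA -(conv_cos_vallee_poussin s e0 ja) /convol.
    rewrite -(RintegralZl _ measurableT (conv_L1 s (bm_cos _) iV)).
    by apply: eq_Rintegral => u _; rewrite !mulrA.
have cD s : D n s @[n --> \oo] --> K a s by exact: cvg_fejer_sum.
have : convol (D n) (V e) t @[n --> \oo] --> convol (K a) (V e) t.
  (* A majorant uniform in [n]: a Fejer sum of order [n + 1] is at most [(n + 1) ^ 2], so
     [|D n| <= a ^+ 2 / 2]. *)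
  have iG := L1Zl (a ^+ 2 / 2) (L1_norm iV).
  apply: (Rintegral_dominated_cvg _ _ iG).
  - by move=> n; exact: (L1_measurable (conv_L1 t (repD n).1 iV)).
  - by move=> s; apply: cvgM; [exact: cD|exact: cvg_cst].
  - move=> n s; rewrite normrM ler_wpM2r// /D.
    have n0 : 0 < n.+1%:R ^+ 2 :> R by rewrite exprn_gt0// ltr0n.
    rewrite normrM ger0_norm ?divr_ge0 ?sqr_ge0// ?(ltW n0)//.
    rewrite -[leLHS]mulrA ler_piMr ?divr_ge0 ?sqr_ge0// mulrC.
    by rewrite ler_pdivrMr// mul1r norm_fejer_sum_le.
under eq_cvg do rewrite (repD _).2.
move=> h; exact: (cvg_unique _ h (cD t)).
Qed.

Lemma conv_fejer_reproduce (g : R -> R) e a y : bounded_meas g -> 0 < e -> `|a| <= e ->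
  convol (convol g (K a)) (V e) y = convol g (K a) y.
Proof.
move=> bg e0 ae.
rewrite (conv_assoc _ bg (bm_fejer_kernel a) (L1_fejer_kernel a) (L1_vallee_poussin e)).
by congr convol; apply/funext => t; exact: conv_fejer_vallee_poussin.
Qed.

End ValleePoussin.

(** * The contraction argument at low frequencies *)

Section LocalTauberian.
Context {R : realType}.
Local Notation mu := (@lebesgue_measure R).
Local Notation K := (@fejer_kernel R).
Local Notation V := (@vallee_poussin R).
Implicit Types (g H p r : R -> R).

(** The bound [B] on [H] holds only near infinity. The excess [E = max(|H| - B, 0)] is bounded and
    eventually 0, so its convolution with [|r|] tends to 0 and is absorbed by [d]. *)
Lemma near_convol_le H r (B eta d : R) : bounded_meas H -> L1 r ->
  \int[mu]_s `|r s| <= eta -> 0 <= B -> 0 < d ->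
  (\forall y \near +oo, `|H y| <= B) ->
  \forall y \near +oo, `|convol H r y| <= B * eta + d.
Proof.
move=> bH ir reta B0 d0 HB; have [mH [M HM]] := bH.
pose E x := Num.max (`|H x| - B) 0.
have E0 x : 0 <= E x by rewrite /E le_max lexx orbT.
have EM x : `|E x| <= Num.max (M - B) 0.
  by rewrite ger0_norm// /E ge_max !le_max lerD2r HM lexx orbT.
have bE : bounded_meas E.
  split; last by exists (Num.max (M - B) 0).
  by apply: measurable_maxr => //; apply: measurable_funB => //; exact: measurableT_comp.
have irn := L1_norm ir.
have Ecvg : E x @[x --> +oo] --> 0.
  apply: cvg_near_cst; apply: filterS HB => y yB.
  by rewrite /E max_r// subr_le0.
have /cvgr0Pnorm_lt /(_ d d0) := conv_cvg0 bE irn Ecvg.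
apply: filterS => y /(le_lt_trans (ler_norm _)) yd.
have iE := conv_L1 y bE irn.
have iB := L1Zl B irn.
apply: (@le_trans _ _ (\int[mu]_s (B * `|r s| + E (y - s) * `|r s|))).
  apply: norm_Rintegral_le; [exact: conv_L1|exact: L1D|move=> s].
  rewrite normrM -mulrDl ler_wpM2r// -lerBlDl /E le_max lexx//.
rewrite (RintegralD measurableT iB iE) (RintegralZl _ measurableT irn).
by rewrite lerD// ?ler_wpM2l// ltW.
Qed.

(** Plays the part of a limsup: starting from a global bound, each eventual bound improves by the
    factor [3 / 4], so all powers of it are reached. *)
Lemma cvg0_contract (u : R -> R) (M : R) : (forall x, u x <= M) -> (forall x, 0 <= u x) ->
  (forall B, 0 < B -> (\forall y \near +oo, u y <= B) ->
     \forall y \near +oo, u y <= 3 / 4 * B) ->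
  u y @[y --> +oo] --> 0.
Proof.
move=> uM u0 uc; pose B0 := M + 1.
have B00 : 0 < B0 by rewrite /B0 (le_lt_trans (le_trans (u0 0) (uM 0)))// ltrDl.
have un n : \forall y \near +oo, u y <= (3 / 4) ^+ n * B0.
  elim: n => [|n IHn]; first by apply: nearW => y; rewrite mul1r /B0 (le_trans (uM y))// lerDl.
  by rewrite exprS -mulrA; apply: uc => //; rewrite mulr_gt0// exprn_gt0.
have cn : (3 / 4) ^+ n * B0 @[n --> \oo] --> 0.
  rewrite -(mul0r B0); apply: cvgM; last exact: cvg_cst.
  by apply: cvg_expr; rewrite ger0_norm//; lra.
apply/cvgr0Pnorm_lt => e e0.
have /cvgr0Pnorm_lt /(_ e e0) [n _ /(_ n (leqnn n))] := cn.
move=> /= /(le_lt_trans (ler_norm _)) ne.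
apply: filterS (un n) => y uy; rewrite ger0_norm//; exact: le_lt_trans ne.
Qed.

(* A lower bound for [|(c1 + i c2) (x1 + i x2)|]. *)
Lemma complex_div_bound (c1 c2 C n x1 x2 b : R) :
  `|c1| + `|c2| <= C -> 0 < n -> n <= c1 ^+ 2 + c2 ^+ 2 ->
  `|c1 * x1 - c2 * x2| <= b -> `|c1 * x2 + c2 * x1| <= b ->
  `|x1| <= C * b / n /\ `|x2| <= C * b / n.
Proof.
move=> cC n0 nc h1 h2.
have b0 : 0 <= b := le_trans (normr_ge0 _) h1.
set y1 := c1 * x1 - c2 * x2 in h1 *; set y2 := c1 * x2 + c2 * x1 in h2 *.
have key a1 a2 z1 z2 x : (c1 ^+ 2 + c2 ^+ 2) * x = a1 * z1 + a2 * z2 ->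
    `|a1| + `|a2| <= C -> `|z1| <= b -> `|z2| <= b -> `|x| <= C * b / n.
  move=> e aC zb1 zb2; rewrite ler_pdivlMr// mulrC.
  apply: (@le_trans _ _ ((c1 ^+ 2 + c2 ^+ 2) * `|x|)); first by rewrite ler_wpM2r.
  have -> : (c1 ^+ 2 + c2 ^+ 2) * `|x| = `|(c1 ^+ 2 + c2 ^+ 2) * x|.
    by rewrite normrM ger0_norm// addr_ge0// sqr_ge0.
  rewrite e (le_trans (ler_normD _ _))// !normrM.
  apply: (@le_trans _ _ (`|a1| * b + `|a2| * b)).
    by rewrite lerD// ler_wpM2l.
  by rewrite -mulrDl ler_wpM2r.
split.
- by apply: (key c1 c2 y1 y2) => //; rewrite /y1 /y2; ring.
- apply: (key c1 (- c2) y2 y1) => //; last by rewrite normrN.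
  by rewrite /y1 /y2; ring.
Qed.

Lemma normB_le (w x y b d : R) : 0 < d -> `|w| < d -> `|x| <= b + d -> `|y| <= b + d ->
  `|w - (x - y)| <= 2 * b + 3 * d.
Proof.
by move=> d0 wd xb yb; have := ler_normB w (x - y); have := ler_normB x y; lra.
Qed.

(* With [H = g * K_a = H * V_e], one has [g * p * K_a = (\int p) H + H * r] where
   [r = V_e * p - (\int p) V_e] is small in [L1]; so the limsup of [|H|] is at most a
   fraction of itself. *)
Lemma local_tauberian (g1 g2 p1 p2 : R -> R) (C n eta e a : R) :
  bounded_meas g1 -> bounded_meas g2 -> L1 p1 -> L1 p2 ->
  let c1 := \int[mu]_s p1 s in let c2 := \int[mu]_s p2 s in
  `|c1| + `|c2| <= C -> 0 < n -> n <= c1 ^+ 2 + c2 ^+ 2 ->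
  0 < e -> `|a| <= e ->
  \int[mu]_s (`|p1 s| * omega (V e) s) <= eta ->
  \int[mu]_s (`|p2 s| * omega (V e) s) <= eta ->
  4 * C * eta <= n ->
  (convol g1 p1 y - convol g2 p2 y) @[y --> +oo] --> 0 ->
  (convol g1 p2 y + convol g2 p1 y) @[y --> +oo] --> 0 ->
  convol g1 (K a) y @[y --> +oo] --> 0 /\ convol g2 (K a) y @[y --> +oo] --> 0.
Proof.
move=> b1 b2 i1 i2 c1 c2 cC n0 nc e0 ae eta1 eta2 small F1 F2.
have iK := L1_fejer_kernel a.
pose H1 := convol g1 (K a); pose H2 := convol g2 (K a).
have bH1 : bounded_meas H1 by exact: conv_bm.
have bH2 : bounded_meas H2 by exact: conv_bm.
have C0 : 0 < C.
  have := normr_ge0 c1; have := normr_ge0 c2.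
  move=> h1 h2; rewrite lt_neqAle (le_trans _ cC) ?addr_ge0// andbT eq_sym.
  apply/eqP => C0; have c10 : `|c1| = 0 by lra.
  have c20 : `|c2| = 0 by lra.
  move/eqP : c10; move/eqP : c20; rewrite !normr_eq0 => /eqP c20 /eqP c10.
  by move: nc; rewrite c10 c20; lra.
have [ir1 r1] := conv_approx_unit (bm_vallee_poussin e) (L1_vallee_poussin e) i1.
have [ir2 r2] := conv_approx_unit (bm_vallee_poussin e) (L1_vallee_poussin e) i2.
have {}r1 := le_trans r1 eta1; have {}r2 := le_trans r2 eta2.
set s1 := (fun u => _) in ir1 r1; set s2 := (fun u => _) in ir2 r2.
have Hp g p y : bounded_meas g -> L1 p -> convol (convol g p) (K a) y =
    (\int[mu]_s p s) * convol g (K a) y +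
    convol (convol g (K a)) (fun u => convol (V e) p u - (\int[mu]_s p s) * V e u) y.
  move=> bg ip; have bH := conv_bm bg iK.
  have iV := L1_vallee_poussin e; have bV := bm_vallee_poussin e.
  have iVp : L1 (convol (V e) p).
    have [ir _] := conv_approx_unit bV iV ip.
    by apply: (eq_L1 _ (L1D ir (L1Zl (\int[mu]_s p s) iV))) => u; rewrite subrK.
  have e1 : convol (convol g (K a)) (fun u => (\int[mu]_s p s) * V e u) y =
      (\int[mu]_s p s) * convol g (K a) y.
    by rewrite (convZr _ y bH iV) (conv_fejer_reproduce y bg e0 ae).
  have e2 : convol (convol g (K a)) (convol (V e) p) y = convol (convol g (K a)) p y.
    have HV : convol (convol g (K a)) (V e) = convol g (K a).
      by apply/funext => z; exact: (conv_fejer_reproduce z bg e0 ae).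
    by rewrite -(conv_assoc y bH bV iV ip) HV.
  rewrite (conv_swap y bg ip iK) (convBr y bH iVp (L1Zl _ iV)) e1 e2.
  by rewrite addrC subrK.
have bg1p1 := conv_bm b1 i1; have bg2p2 := conv_bm b2 i2.
have bg1p2 := conv_bm b1 i2; have bg2p1 := conv_bm b2 i1.
have G1 : (convol (convol g1 p1) (K a) y - convol (convol g2 p2) (K a) y) @[y --> +oo] --> 0.
  have E : (fun y => convol (convol g1 p1) (K a) y - convol (convol g2 p2) (K a) y) =
      convol (fun y => convol g1 p1 y - convol g2 p2 y) (K a).
    by apply/funext => y; rewrite (convBl y bg1p1 bg2p2 iK).
  by rewrite E; exact: (conv_cvg0 (bmB bg1p1 bg2p2) iK F1).
have G2 : (convol (convol g1 p2) (K a) y + convol (convol g2 p1) (K a) y) @[y --> +oo] --> 0.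
  have E : (fun y => convol (convol g1 p2) (K a) y + convol (convol g2 p1) (K a) y) =
      convol (fun y => convol g1 p2 y + convol g2 p1 y) (K a).
    by apply/funext => y; rewrite (convDl y bg1p2 bg2p1 iK).
  by rewrite E; exact: (conv_cvg0 (bmD bg1p2 bg2p1) iK F2).
(* The equations couple [H1] and [H2], so neither contracts by itself; their maximum does. *)
suff : Num.max `|H1 y| `|H2 y| @[y --> +oo] --> 0.
  move=> h; split; apply/cvgr0Pnorm_lt => d d0; move/cvgr0Pnorm_lt : h => /(_ d d0);
    apply: filterS => y; apply: le_lt_trans; rewrite (le_trans _ (ler_norm _))// le_max lexx ?orbT//.
have [_ [M1 HM1]] := bH1; have [_ [M2 HM2]] := bH2.
apply: (@cvg0_contract _ (Num.max M1 M2)) => [y|y|B B0 HB].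
- by rewrite ge_max !le_max HM1 HM2 orbT.
- by rewrite le_max normr_ge0.
have HB1 : \forall y \near +oo, `|H1 y| <= B.
  by apply: filterS HB => y; rewrite ge_max => /andP[].
have HB2 : \forall y \near +oo, `|H2 y| <= B.
  by apply: filterS HB => y; rewrite ge_max => /andP[].
(* Chosen so that the three errors [d] contribute [C * (3 * d) / n = B / 4]; the hypothesis on [eta]
   bounds the remaining part by [B / 2], which gives [3 / 4 * B]. *)
pose d := B * n / (12 * C).
have d0 : 0 < d by rewrite divr_gt0// mulr_gt0.
have B0' := ltW B0.
have N11 := near_convol_le bH1 ir1 r1 B0' d0 HB1.
have N12 := near_convol_le bH1 ir2 r2 B0' d0 HB1.
have N21 := near_convol_le bH2 ir1 r1 B0' d0 HB2.
have N22 := near_convol_le bH2 ir2 r2 B0' d0 HB2.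
have /cvgr0Pnorm_lt /(_ d d0) NG1 := G1.
have /cvgr0Pnorm_lt /(_ d d0) NG2 := G2.
have bnd : C * (2 * (B * eta) + 3 * d) / n <= 3 / 4 * B.
  rewrite ler_pdivrMr// mulrDr.
  have -> : C * (3 * d) = B * n / 4 by rewrite /d; field; rewrite gt_eqF.
  have : C * (2 * (B * eta)) <= B * n / 2.
    have -> : C * (2 * (B * eta)) = B / 2 * (4 * C * eta) by field.
    have -> : B * n / 2 = B / 2 * n by rewrite mulrAC.
    by rewrite ler_wpM2l// divr_ge0.
  have -> : 3 / 4 * B * n = B * n / 2 + B * n / 4 by field.
  by rewrite lerD2r.
pose A y := `|convol H1 s1 y| <= B * eta + d /\ `|convol H1 s2 y| <= B * eta + d.
pose A' y := `|convol H2 s1 y| <= B * eta + d /\ `|convol H2 s2 y| <= B * eta + d.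
pose A'' y := `|convol (convol g1 p1) (K a) y - convol (convol g2 p2) (K a) y| < d /\
  `|convol (convol g1 p2) (K a) y + convol (convol g2 p1) (K a) y| < d.
have NA : \forall y \near +oo, A y by exact: (filterI N11 N12).
have NA' : \forall y \near +oo, A' y by exact: (filterI N21 N22).
have NA'' : \forall y \near +oo, A'' y by exact: (filterI NG1 NG2).
move: NA NA' NA''; apply: filterS3 => y [a11 a12] [a21 a22] [g1d g2d].
have E11 : convol (convol g1 p1) (K a) y = c1 * H1 y + convol H1 s1 y := Hp g1 p1 y b1 i1.
have E12 : convol (convol g1 p2) (K a) y = c2 * H1 y + convol H1 s2 y := Hp g1 p2 y b1 i2.
have E21 : convol (convol g2 p1) (K a) y = c1 * H2 y + convol H2 s1 y := Hp g2 p1 y b2 i1.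
have E22 : convol (convol g2 p2) (K a) y = c2 * H2 y + convol H2 s2 y := Hp g2 p2 y b2 i2.
move: g1d g2d a11 a12 a21 a22; rewrite E11 E12 E21 E22.
move: (convol H1 s1 y) (convol H1 s2 y) (convol H2 s1 y) (convol H2 s2 y).
move: (H1 y) (H2 y) => x1 x2 z11 z12 z21 z22 g1d g2d a11 a12 a21 a22.
(* Division by [c1 + i c2]. Each component is a term below [d] minus a combination of two
   convolutions bounded by [B * eta + d], hence the bound [2 * (B * eta) + 3 * d]. *)
have [||h1 h2] := @complex_div_bound c1 c2 C n x1 x2 (2 * (B * eta) + 3 * d) cC n0 nc.
- have -> : c1 * x1 - c2 * x2 = (c1 * x1 + z11 - (c2 * x2 + z22)) - (z11 - z22) by ring.
  exact: normB_le.
- have -> : c1 * x2 + c2 * x1 = (c2 * x1 + z12 + (c1 * x2 + z21)) - (z12 + z21) by ring.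
  by rewrite -[z21 in X in _ - X]opprK; apply: normB_le => //; rewrite normrN.
by rewrite ge_max (le_trans h1 bnd) (le_trans h2 bnd).
Qed.

End LocalTauberian.

(** * From Fejer kernels to arbitrary integrable kernels; continuity of Fourier transforms *)

Section WienerTauberian.
Context {R : realType}.
Local Notation mu := (@lebesgue_measure R).
Local Notation K := (@fejer_kernel R).
Local Notation V := (@vallee_poussin R).
Local Notation c := (@fejer_mass R).
Implicit Types (f g p q : R -> R).

(** Dominated convergence, as [omega q] is bounded and tends to 0 at 0. It serves twice: with
    [q = V 1] for the contraction, and with [p = K 1] for the approximate identity. *)
Lemma cvg_Rintegral_omega q p : L1 q -> L1 p ->
  \int[mu]_s (p s * omega q (harmonic n * s)) @[n --> \oo] --> 0.
Proof.
move=> iq ip; have mp := L1_measurable ip.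
have -> : 0 = \int[mu]_(x in setT) (0:R) :> R by rewrite Rintegral_cst// mul0r.
apply: (@Rintegral_dominated_cvg _ _ _ (fun s => (2 * \int[mu]_x `|q x|) * `|p s|)).
- move=> n; apply: measurable_funM => //.
  by apply: measurableT_comp; [exact: measurable_omega|exact: mulrl_measurable].
- move=> s; rewrite -(mulr0 (p s)); apply: cvgM; first exact: cvg_cst.
  have h : (harmonic n * s : R) @[n --> \oo] --> 0.
    by rewrite -(mul0r s); apply: cvgM; [exact: cvg_harmonic|exact: cvg_cst].
  exact: (cvg_comp _ _ h (omega_cvg0 iq)).
- exact/L1Zl/L1_norm.
- move=> n s; rewrite normrM mulrC ler_wpM2r// ger0_norm ?omega_ge0//.
  exact: omega_le.
Qed.

(** The kernels [K N / (c * N)] form an approximate identity as [N] grows. They approximate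
    [F = f * q] uniformly because [F] inherits its modulus of continuity from [q], while the
    convolution of [F] with [K N] tends to 0 because that of [f] does. *)
Lemma conv_cvg0_fejer f q : bounded_meas f -> L1 q ->
  (forall n, convol f (K n.+1%:R) y @[y --> +oo] --> 0) ->
  convol f q y @[y --> +oo] --> 0.
Proof.
move=> bf iq fK; have [_ [M fM]] := bf.
pose F := convol f q; have bF : bounded_meas F by exact: conv_bm.
have c0 := @fejer_mass_gt0 R.
have FK n : convol F (K n.+1%:R) y @[y --> +oo] --> 0.
  have := conv_cvg0 (conv_bm bf (L1_fejer_kernel n.+1%:R)) iq (fK n).
  have -> // : convol F (K n.+1%:R) = convol (convol f (K n.+1%:R)) q.
  by apply/funext => y; rewrite /F conv_swap//; exact: L1_fejer_kernel.
have iw n : L1 (fun s => K 1 s * omega q (harmonic n * s)).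
  apply: (le_L1 _ _ (L1Zl (2 * \int[mu]_x `|q x|) (L1_fejer_kernel 1))).
    apply: measurable_funM; first exact: measurable_fejer_kernel.
    by apply: measurableT_comp; [exact: measurable_omega|exact: mulrl_measurable].
  move=> s; rewrite normrM mulrC !ger0_norm ?omega_ge0 ?fejer_kernel_ge0// ler_wpM2r ?fejer_kernel_ge0//.
  exact: omega_le.
pose w n := \int[mu]_s (K 1 s * omega q (harmonic n * s)).
have w0 : w n @[n --> \oo] --> 0 by exact: (cvg_Rintegral_omega iq (L1_fejer_kernel 1)).
(* The substitution by [n + 1], with [K N s = N ^ 2 * K 1 (N * s)], turns the average of [omega q]
   against [K N] into [N * w n]. *)
have wE n : w n * n.+1%:R = \int[mu]_s (omega q s * K n.+1%:R s) /\
    L1 (fun s => omega q s * K n.+1%:R s).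
  have n0 : n.+1%:R != 0 :> R by rewrite pnatr_eq0.
  have hn : harmonic n = n.+1%:R^-1 :> R by [].
  have E s : K 1 (n.+1%:R * s + 0) * omega q (harmonic n * (n.+1%:R * s + 0)) =
      n.+1%:R ^- 2 * (omega q s * K n.+1%:R s).
    by rewrite addr0 hn (mulKf n0) (fejer_kernel_scale n.+1%:R) [in RHS]mulrCA mulKf ?sqrf_eq0// mulrC.
  have i1 : L1 (fun s => n.+1%:R ^- 2 * (omega q s * K n.+1%:R s)).
    by apply: (eq_L1 _ (L1_affine 0 n0 (iw n))) => s; rewrite E.
  have i2 : L1 (fun s => omega q s * K n.+1%:R s).
    by apply: (eq_L1 _ (L1Zl (n.+1%:R ^+ 2) i1)) => s; rewrite mulVKf// sqrf_eq0.
  split=> //; rewrite /w (Rintegral_affine 0 n0 (iw n)).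
  under eq_Rintegral do rewrite E.
  rewrite (RintegralZl _ measurableT i2) normr_nat; move: n0; move: (n.+1%:R : R) => N N0.
  by move: (\int[mu]_x _) => I; field.
(* [c * N * F y] is the integral of [F y * K N s]; comparing it with the convolution leaves the
   increments [F (y - s) - F y], bounded by [M * omega q s] whatever [y] is. *)
have key n y : c * n.+1%:R * `|F y| <= `|convol F (K n.+1%:R) y| + M * (w n * n.+1%:R).
  have [-> i2] := wE n; have iK : L1 (K n.+1%:R) by exact: L1_fejer_kernel.
  have FE : c * n.+1%:R * F y = \int[mu]_s (F y * K n.+1%:R s).
    by rewrite (RintegralZl _ measurableT iK) Rintegral_fejer_kernel normr_nat mulrC.
  rewrite -[c * _ * `|_|](_ : `|c * n.+1%:R * F y| = _); last first.
    by rewrite normrM ger0_norm// mulr_ge0// ltW.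
  rewrite FE -lerBlDl.
  apply: (le_trans (lerB_dist _ _)); rewrite distrC.
  have iF := conv_L1 y bF iK; have iFy := L1Zl (F y) iK.
  rewrite -(RintegralB measurableT iF iFy) -(RintegralZl _ measurableT i2).
  apply: norm_Rintegral_le; [exact: L1B|exact: L1Zl|move=> s].
  rewrite -mulrBl normrM (ger0_norm (fejer_kernel_ge0 _ _)) mulrA ler_wpM2r ?fejer_kernel_ge0//.
  exact: conv_modulus.
apply/cvgr0Pnorm_lt => e e0.
have Mw0 : M * w n / c @[n --> \oo] --> 0.
  rewrite -(mul0r c^-1) -(mulr0 M); apply: cvgM; last exact: cvg_cst.
  by apply: cvgM => //; exact: cvg_cst.
have e20 : 0 < e / 2 by rewrite divr_gt0.
have /cvgr0Pnorm_lt /(_ _ e20) [n _ /(_ n (leqnn n))] := Mw0.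
move=> /= /(le_lt_trans (ler_norm _)) wn.
have N0 : 0 < c * n.+1%:R by rewrite mulr_gt0.
have d0 : 0 < c * n.+1%:R * (e / 2) by rewrite mulr_gt0.
have /cvgr0Pnorm_lt /(_ _ d0) := FK n; apply: filterS => y yd.
rewrite -(ltr_pM2l N0) (le_lt_trans (key n y))//.
have -> : c * n.+1%:R * e = c * n.+1%:R * (e / 2) + c * n.+1%:R * (e / 2) by field.
rewrite ltrD//; have -> : M * (w n * n.+1%:R) = M * w n * n.+1%:R by rewrite mulrA.
have -> : c * n.+1%:R * (e / 2) = e / 2 * c * n.+1%:R by rewrite mulrC mulrA.
by rewrite ltr_pM2r// -ltr_pdivrMr.
Qed.

Lemma continuous_Rintegral_cos p : L1 p -> continuous (fun x : R => \int[mu]_s (cos (x * s) * p s)).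
Proof.
move=> ip x; apply/(@cvg_nbhsP R R^o) => u ux.
apply: (Rintegral_dominated_cvg _ _ (L1_norm ip)).
- by move=> n; exact: (L1_measurable (L1_bmM (bm_cos (u n)) ip)).
- move=> s; apply: cvgM; last exact: cvg_cst.
  apply: (continuous_cvg _ (@continuous_cos R (x * s))).
  by apply: cvgM => //; exact: cvg_cst.
- by move=> n s; rewrite normrM ler_piMl// cos_max.
Qed.

Lemma continuous_Rintegral_sin p : L1 p -> continuous (fun x : R => \int[mu]_s (sin (x * s) * p s)).
Proof.
move=> ip x; apply/(@cvg_nbhsP R R^o) => u ux.
apply: (Rintegral_dominated_cvg _ _ (L1_norm ip)).
- by move=> n; exact: (L1_measurable (L1_bmM (bm_sin (u n)) ip)).
- move=> s; apply: cvgM; last exact: cvg_cst.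
  apply: (continuous_cvg _ (@continuous_sin R (x * s))).
  by apply: cvgM => //; exact: cvg_cst.
- by move=> n s; rewrite normrM ler_piMl// sin_max.
Qed.

End WienerTauberian.

(** * Moving the contraction to an arbitrary frequency *)

Section Modulation.
Context {R : realType}.
Local Notation mu := (@lebesgue_measure R).
Local Notation K := (@fejer_kernel R).
Local Notation V := (@vallee_poussin R).
Implicit Types (f g p q : R -> R).

(* Real and imaginary parts of [e^{-ixs} (f1 s + i f2 s)]. *)
Definition mod_re (x : R) f1 f2 s : R := cos (x * s) * f1 s + sin (x * s) * f2 s.
Definition mod_im (x : R) f1 f2 s : R := cos (x * s) * f2 s - sin (x * s) * f1 s.

Lemma bm_mod_re x f1 f2 : bounded_meas f1 -> bounded_meas f2 -> bounded_meas (mod_re x f1 f2).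
Proof. by move=> b1 b2; apply: bmD; apply: bmM => //; [exact: bm_cos|exact: bm_sin]. Qed.

Lemma bm_mod_im x f1 f2 : bounded_meas f1 -> bounded_meas f2 -> bounded_meas (mod_im x f1 f2).
Proof. by move=> b1 b2; apply: bmB; apply: bmM => //; [exact: bm_cos|exact: bm_sin]. Qed.

Lemma L1_mod_re x p1 p2 : L1 p1 -> L1 p2 -> L1 (mod_re x p1 p2).
Proof. by move=> b1 b2; apply: L1D; apply: L1_bmM => //; [exact: bm_cos|exact: bm_sin]. Qed.

Lemma L1_mod_im x p1 p2 : L1 p1 -> L1 p2 -> L1 (mod_im x p1 p2).
Proof. by move=> b1 b2; apply: L1B; apply: L1_bmM => //; [exact: bm_cos|exact: bm_sin]. Qed.

Lemma norm_mod_re x p1 p2 s : `|mod_re x p1 p2 s| <= `|p1 s| + `|p2 s|.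
Proof.
rewrite (le_trans (ler_normD _ _))// !normrM.
by rewrite lerD// ler_piMl// ?cos_max ?sin_max.
Qed.

Lemma norm_mod_im x p1 p2 s : `|mod_im x p1 p2 s| <= `|p1 s| + `|p2 s|.
Proof.
rewrite (le_trans (ler_normB _ _))// !normrM addrC.
by rewrite lerD// ler_piMl// ?cos_max ?sin_max.
Qed.

Lemma conv_combine (a b : R) f1 f2 p1 p2 y : bounded_meas f1 -> bounded_meas f2 ->
  L1 p1 -> L1 p2 ->
  a * convol f1 p1 y + b * convol f2 p2 y =
  \int[mu]_s (a * (f1 (y - s) * p1 s) + b * (f2 (y - s) * p2 s)) /\
  L1 (fun s => a * (f1 (y - s) * p1 s) + b * (f2 (y - s) * p2 s)).
Proof.
move=> b1 b2 i1 i2; have j1 := conv_L1 y b1 i1; have j2 := conv_L1 y b2 i2.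
split; last by apply: L1D; exact: L1Zl.
rewrite (RintegralD measurableT (L1Zl a j1) (L1Zl b j2)).
by rewrite (RintegralZl _ measurableT j1) (RintegralZl _ measurableT j2).
Qed.

(** The complex identity (e_x f) * (e_x p) = e_x (f * p), for e_x(s) = e^{-ixs}, in real and
    imaginary parts. *)
Lemma conv_mod x f1 f2 p1 p2 y : bounded_meas f1 -> bounded_meas f2 -> L1 p1 -> L1 p2 ->
  convol (mod_re x f1 f2) (mod_re x p1 p2) y - convol (mod_im x f1 f2) (mod_im x p1 p2) y =
    cos (x * y) * (convol f1 p1 y - convol f2 p2 y) +
    sin (x * y) * (convol f1 p2 y + convol f2 p1 y) /\
  convol (mod_re x f1 f2) (mod_im x p1 p2) y + convol (mod_im x f1 f2) (mod_re x p1 p2) y =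
    cos (x * y) * (convol f1 p2 y + convol f2 p1 y) -
    sin (x * y) * (convol f1 p1 y - convol f2 p2 y).
Proof.
move=> b1 b2 i1 i2.
have br := bm_mod_re x b1 b2; have bi := bm_mod_im x b1 b2.
have ir := L1_mod_re x i1 i2; have ii := L1_mod_im x i1 i2.
have [eA iA] := conv_combine 1 (-1) y b1 b2 i1 i2.
have [eB iB] := conv_combine 1 1 y b1 b2 i2 i1.
have [eA' _] := conv_combine 1 (-1) y br bi ir ii.
have [eB' _] := conv_combine 1 1 y br bi ii ir.
rewrite !mul1r mulN1r in eA; rewrite !mul1r mulN1r in eA'; rewrite !mul1r in eB; rewrite !mul1r in eB'.
rewrite eA eB eA' eB'.
rewrite -!(RintegralZl _ measurableT iA) -!(RintegralZl _ measurableT iB).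
have xy s : x * y = x * (y - s) + x * s by ring.
split.
- rewrite -(RintegralD measurableT (L1Zl _ iA) (L1Zl _ iB)).
  apply: eq_Rintegral => s _; rewrite (xy s) cosD sinD /mod_re /mod_im.
  by move: (cos (x * (y - s))) (sin (x * (y - s))) => a b; ring.
- rewrite -(RintegralB measurableT (L1Zl _ iB) (L1Zl _ iA)).
  apply: eq_Rintegral => s _; rewrite (xy s) cosD sinD /mod_re /mod_im.
  by move: (cos (x * (y - s))) (sin (x * (y - s))) => a b; ring.
Qed.

(** For real [p], the complex identity saying that convolving [f] with [e^{ixs} p(s)] gives
    [e^{ixy}] times the convolution of [e^{-ixs} f(s)] with [p]. *)
Lemma conv_demod x f1 f2 p y : bounded_meas f1 -> bounded_meas f2 -> L1 p ->
  convol f1 (fun s => cos (x * s) * p s) y - convol f2 (fun s => sin (x * s) * p s) y =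
    cos (x * y) * convol (mod_re x f1 f2) p y - sin (x * y) * convol (mod_im x f1 f2) p y /\
  convol f2 (fun s => cos (x * s) * p s) y + convol f1 (fun s => sin (x * s) * p s) y =
    cos (x * y) * convol (mod_im x f1 f2) p y + sin (x * y) * convol (mod_re x f1 f2) p y.
Proof.
move=> b1 b2 i.
have br := bm_mod_re x b1 b2; have bi := bm_mod_im x b1 b2.
have ic := L1_bmM (bm_cos x) i; have isn := L1_bmM (bm_sin x) i.
have [eA _] := conv_combine 1 (-1) y b1 b2 ic isn.
have [eB _] := conv_combine 1 1 y b2 b1 ic isn.
have [eA' _] := conv_combine (cos (x * y)) (- sin (x * y)) y br bi i i.
have [eB' _] := conv_combine (cos (x * y)) (sin (x * y)) y bi br i i.
rewrite !mul1r mulN1r in eA; rewrite !mul1r in eB; rewrite mulNr in eA'.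
rewrite eA eB eA' eB'.
have xy s : x * s = x * y - x * (y - s) by ring.
split; apply: eq_Rintegral => s _; rewrite (xy s) cosB sinB /mod_re /mod_im;
  move: (cos (x * (y - s))) (sin (x * (y - s))) (cos (x * y)) (sin (x * y)) => a b a' b'; ring.
Qed.

Lemma cvg0_mul_norm1 (u A : R -> R) : (forall y, `|u y| <= 1) ->
  A y @[y --> +oo] --> 0 -> u y * A y @[y --> +oo] --> 0.
Proof.
move=> u1 /cvgr0Pnorm_lt A0; apply/cvgr0Pnorm_lt => e /A0.
by apply: filterS => y; apply: le_lt_trans; rewrite normrM ler_piMl.
Qed.

Lemma cvg0_mod (x : R) (A B : R -> R) : A y @[y --> +oo] --> 0 -> B y @[y --> +oo] --> 0 ->
  (cos (x * y) * A y + sin (x * y) * B y) @[y --> +oo] --> 0 /\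
  (cos (x * y) * A y - sin (x * y) * B y) @[y --> +oo] --> 0.
Proof.
move=> A0 B0.
have cA := cvg0_mul_norm1 (fun y => cos_max (x * y)) A0.
have sB := cvg0_mul_norm1 (fun y => sin_max (x * y)) B0.
split; first by rewrite -(addr0 0); exact: cvgD.
by rewrite -(subr0 0); exact: cvgB.
Qed.

(** Modulating both [f] and [p] brings frequency [x] to 0, where the local result applies, and the
    outcome is modulated back. The conditions on [C] and [eta] involve [|p1| + |p2|], which
    dominates both components of every modulation of [p], so they do not depend on [x]. *)
Lemma modulated_tauberian f1 f2 p1 p2 (x C n eta e a : R) :
  bounded_meas f1 -> bounded_meas f2 -> L1 p1 -> L1 p2 ->
  2 * (\int[mu]_s (`|p1 s| + `|p2 s|)) <= C -> 0 < n ->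
  n <= (\int[mu]_s mod_re x p1 p2 s) ^+ 2 + (\int[mu]_s mod_im x p1 p2 s) ^+ 2 ->
  0 < e -> `|a| <= e ->
  \int[mu]_s ((`|p1 s| + `|p2 s|) * omega (V e) s) <= eta ->
  4 * C * eta <= n ->
  (convol f1 p1 y - convol f2 p2 y) @[y --> +oo] --> 0 ->
  (convol f1 p2 y + convol f2 p1 y) @[y --> +oo] --> 0 ->
  (convol f1 (fun s => cos (x * s) * K a s) y -
   convol f2 (fun s => sin (x * s) * K a s) y) @[y --> +oo] --> 0 /\
  (convol f2 (fun s => cos (x * s) * K a s) y +
   convol f1 (fun s => sin (x * s) * K a s) y) @[y --> +oo] --> 0.
Proof.
move=> b1 b2 i1 i2 CP n0 nF e0 ae etaP small A0 B0.
have ir := L1_mod_re x i1 i2; have ii := L1_mod_im x i1 i2.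
have iP := L1D (L1_norm i1) (L1_norm i2).
have iV := L1_vallee_poussin e; have bV := bm_vallee_poussin e.
have iPo : forall q, L1 q -> L1 (fun s => q s * omega (V e) s).
  move=> q iq; apply: (eq_L1 (p := fun s => omega (V e) s * q s)).
    by move=> s; rewrite mulrC.
  apply: L1_bmM => //; split; first exact: measurable_omega.
  by exists (2 * \int[mu]_x `|V e x|) => s; rewrite ger0_norm ?omega_ge0// omega_le.
have le_eta q : L1 q -> (forall s, `|q s| <= `|p1 s| + `|p2 s|) ->
    \int[mu]_s (`|q s| * omega (V e) s) <= eta.
  move=> iq qP; apply: le_trans etaP; apply: le_Rintegral => //.
  - exact: (iPo _ (L1_norm iq)).
  - exact: (iPo _ iP).
  - by move=> s _; rewrite ler_wpM2r ?omega_ge0.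
have cC : `|\int[mu]_s mod_re x p1 p2 s| + `|\int[mu]_s mod_im x p1 p2 s| <= C.
  apply: le_trans CP; rewrite mulr_natl mulr2n lerD//; apply: norm_Rintegral_le => // s.
    exact: norm_mod_re.
  exact: norm_mod_im.
have [||G1 G2] := @local_tauberian R (mod_re x f1 f2) (mod_im x f1 f2) _ _ C n eta e a
  (bm_mod_re x b1 b2) (bm_mod_im x b1 b2) ir ii cC n0 nF e0 ae
  (le_eta _ ir (norm_mod_re x p1 p2)) (le_eta _ ii (norm_mod_im x p1 p2)) small.
- have E : (fun y => convol (mod_re x f1 f2) (mod_re x p1 p2) y - convol (mod_im x f1 f2) (mod_im x p1 p2) y) =
    (fun y => cos (x * y) * (convol f1 p1 y - convol f2 p2 y) +
      sin (x * y) * (convol f1 p2 y + convol f2 p1 y)).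
    by apply/funext => y; rewrite (conv_mod x y b1 b2 i1 i2).1.
  by rewrite E; exact: (cvg0_mod x A0 B0).1.
- have E : (fun y => convol (mod_re x f1 f2) (mod_im x p1 p2) y + convol (mod_im x f1 f2) (mod_re x p1 p2) y) =
    (fun y => cos (x * y) * (convol f1 p2 y + convol f2 p1 y) -
      sin (x * y) * (convol f1 p1 y - convol f2 p2 y)).
    by apply/funext => y; rewrite (conv_mod x y b1 b2 i1 i2).2.
  by rewrite E; exact: (cvg0_mod x B0 A0).2.
have iK := L1_fejer_kernel a; split.
- have E : (fun y => convol f1 (fun s => cos (x * s) * K a s) y - convol f2 (fun s => sin (x * s) * K a s) y) =
    (fun y => cos (x * y) * convol (mod_re x f1 f2) (K a) y - sin (x * y) * convol (mod_im x f1 f2) (K a) y).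
    by apply/funext => y; rewrite (conv_demod x y b1 b2 iK).1.
  by rewrite E; exact: (cvg0_mod x G1 G2).2.
- have E : (fun y => convol f2 (fun s => cos (x * s) * K a s) y + convol f1 (fun s => sin (x * s) * K a s) y) =
    (fun y => cos (x * y) * convol (mod_im x f1 f2) (K a) y + sin (x * y) * convol (mod_re x f1 f2) (K a) y).
    by apply/funext => y; rewrite (conv_demod x y b1 b2 iK).2.
  by rewrite E; exact: (cvg0_mod x G2 G1).1.
Qed.

End Modulation.

(** * Wiener's theorem for pairs of real functions *)

Section WienerTheorem.
Context {R : realType}.
Local Notation mu := (@lebesgue_measure R).
Local Notation K := (@fejer_kernel R).
Local Notation V := (@vallee_poussin R).
Implicit Types (f g p q : R -> R).

(** An exact identity, in which the width [m * a] may be large while [a] is as small as the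
    contraction demands. At [t = 0] both sides are [m ^ 2 * a ^ 2 / 2], thanks to the continuous
    extension. *)
Lemma fejer_kernel_sum (a t : R) (m : nat) :
  K (m%:R * a) t = fejer_sum m (a * t) * K a t.
Proof.
have [->|t0] := eqVneq t 0.
  by rewrite mulr0 fejer_sum0 /K eqxx exprMn mulrA.
by rewrite /K (negbTE t0) mulrA fejer_sumM mulrA.
Qed.

Lemma continuous_mod_norm p1 p2 : L1 p1 -> L1 p2 ->
  continuous (fun x : R => (\int[mu]_s mod_re x p1 p2 s) ^+ 2 + (\int[mu]_s mod_im x p1 p2 s) ^+ 2).
Proof.
move=> i1 i2.
have Er : (fun x : R => \int[mu]_s mod_re x p1 p2 s) =
    (fun x => \int[mu]_s (cos (x * s) * p1 s) + \int[mu]_s (sin (x * s) * p2 s)).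
  apply/funext => x; rewrite -RintegralD//; apply: L1_bmM => //; [exact: bm_cos|exact: bm_sin].
have Ei : (fun x : R => \int[mu]_s mod_im x p1 p2 s) =
    (fun x => \int[mu]_s (cos (x * s) * p2 s) - \int[mu]_s (sin (x * s) * p1 s)).
  apply/funext => x; rewrite -RintegralB//; apply: L1_bmM => //; [exact: bm_cos|exact: bm_sin].
have cr : continuous (fun x : R => \int[mu]_s mod_re x p1 p2 s).
  rewrite Er => x; apply: cvgD; [exact: continuous_Rintegral_cos|exact: continuous_Rintegral_sin].
have ci : continuous (fun x : R => \int[mu]_s mod_im x p1 p2 s).
  rewrite Ei => x; apply: cvgB; [exact: continuous_Rintegral_cos|exact: continuous_Rintegral_sin].
by move=> x; apply: cvgD; [exact: (cvgM (cr x) (cr x))|exact: (cvgM (ci x) (ci x))].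
Qed.

Section Wiener.
Variables (f1 f2 p1 p2 : R -> R).
Hypotheses (b1 : bounded_meas f1) (b2 : bounded_meas f2) (i1 : L1 p1) (i2 : L1 p2).
Hypothesis F0 : forall x : R,
  (\int[mu]_s mod_re x p1 p2 s) ^+ 2 + (\int[mu]_s mod_im x p1 p2 s) ^+ 2 != 0.
Hypothesis A0 : (convol f1 p1 y - convol f2 p2 y) @[y --> +oo] --> 0.
Hypothesis B0 : (convol f1 p2 y + convol f2 p1 y) @[y --> +oo] --> 0.

(** The squared modulus of the transform is continuous and positive, so it has a positive minimum on
    [-N, N], from which [e] is chosen. Using both [x] and [- x] separates the cosine part, and with
    it [f1] from [f2]. *)
Let cvg0_cos_fejer_kernel (N : R) : 0 < N -> exists2 e : R, 0 < e &
  forall x a, `|x| <= N -> `|a| <= e ->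
  convol f1 (fun s => cos (x * s) * K a s) y @[y --> +oo] --> 0 /\
  convol f2 (fun s => cos (x * s) * K a s) y @[y --> +oo] --> 0.
Proof.
move=> N0; pose F x := (\int[mu]_s mod_re x p1 p2 s) ^+ 2 + (\int[mu]_s mod_im x p1 p2 s) ^+ 2.
have NN : - N <= N by lra.
have [x0 _ Fx0] := EVT_min NN (continuous_subspaceT (continuous_mod_norm i1 i2)).
have n0 : 0 < F x0 by rewrite lt_neqAle eq_sym F0/= addr_ge0// sqr_ge0.
have iP := L1D (L1_norm i1) (L1_norm i2).
(* The added 1 makes [C] positive, so that it can be divided by. *)
pose C := 2 * (\int[mu]_s (`|p1 s| + `|p2 s|)) + 1.
have C0 : 0 < C by rewrite ltr_wpDl// mulr_ge0// Rintegral_ge0// => s _; rewrite addr_ge0.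
have C40 : 0 < 4 * C by rewrite mulr_gt0.
have w0 := cvg_Rintegral_omega (L1_vallee_poussin 1) iP.
have d0 : 0 < F x0 / (4 * C) by rewrite divr_gt0.
have /cvgr0Pnorm_lt /(_ _ d0) [k _ /(_ k (leqnn k))] := w0.
move=> /= /(le_lt_trans (ler_norm _)) wk.
have e0 : 0 < harmonic k :> R by rewrite /harmonic invr_gt0 ltr0n.
exists (harmonic k) => // x a xN ae.
have iK := L1_fejer_kernel a.
have small : 4 * C * \int[mu]_s ((`|p1 s| + `|p2 s|) * omega (V 1) (harmonic k * s)) <= F x0.
  by rewrite mulrC -ler_pdivlMr// ltW.
have etaE : \int[mu]_s ((`|p1 s| + `|p2 s|) * omega (V (harmonic k)) s) <=
    \int[mu]_s ((`|p1 s| + `|p2 s|) * omega (V 1) (harmonic k * s)).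
  by rewrite le_eqVlt; apply/orP; left; apply/eqP; apply: eq_Rintegral => s _; rewrite omega_vallee_poussin.
have CP : 2 * (\int[mu]_s (`|p1 s| + `|p2 s|)) <= C by rewrite lerDl.
have Fx z : `|z| <= N -> F x0 <= F z by move=> zN; apply: Fx0; rewrite in_itv/= -ler_norml.
have [X1 X2] := modulated_tauberian b1 b2 i1 i2 CP n0 (Fx x xN) e0 ae etaE small A0 B0.
have xN' : `|- x| <= N by rewrite normrN.
have [Y1 Y2] := modulated_tauberian b1 b2 i1 i2 CP n0 (Fx _ xN') e0 ae etaE small A0 B0.
have cosE : (fun s => cos (- x * s) * K a s) = (fun s => cos (x * s) * K a s).
  by apply/funext => s; rewrite mulNr cosN.
have sinE : (fun s => sin (- x * s) * K a s) = (fun s => - 1 * (sin (x * s) * K a s)).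
  by apply/funext => s; rewrite (mulNr x) sinN mulN1r mulNr.
rewrite cosE sinE in Y1 Y2.
have isn := L1_bmM (bm_sin x) iK.
(* Replacing [x] by [- x] changes the sign of the sine terms only; half the sum of the two limits
   isolates the cosine term. *)
have half (u w : R -> R) : (u y - w y) @[y --> +oo] --> 0 -> (u y + w y) @[y --> +oo] --> 0 ->
    u y @[y --> +oo] --> 0.
  move=> h1 h2.
  have -> : u = (fun y => 2^-1 * ((u y - w y) + (u y + w y))) by apply/funext => y; field.
  rewrite -(mulr0 2^-1) -[in X in _ --> X](addr0 0).
  by apply: cvgM; [exact: cvg_cst|exact: cvgD].
split.
- apply: (half _ (convol f2 (fun s => sin (x * s) * K a s)) X1).
  have E : (fun y => convol f1 (fun s => cos (x * s) * K a s) y + convol f2 (fun s => sin (x * s) * K a s) y) =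
    (fun y => convol f1 (fun s => cos (x * s) * K a s) y - convol f2 (fun s => -1 * (sin (x * s) * K a s)) y).
    by apply/funext => y; rewrite (convZr _ y b2 isn) mulN1r opprK.
  by rewrite E.
- apply: (half _ (convol f1 (fun s => sin (x * s) * K a s)) _ X2).
  have E : (fun y => convol f2 (fun s => cos (x * s) * K a s) y - convol f1 (fun s => sin (x * s) * K a s) y) =
    (fun y => convol f2 (fun s => cos (x * s) * K a s) y + convol f1 (fun s => -1 * (sin (x * s) * K a s)) y).
    by apply/funext => y; rewrite (convZr _ y b1 isn) mulN1r.
  by rewrite E.
Qed.

Let cvg0_fejer_kernel (N : R) : 0 < N ->
  convol f1 (K N) y @[y --> +oo] --> 0 /\ convol f2 (K N) y @[y --> +oo] --> 0.
Proof.
move=> N0; have [e e0 He] := cvg0_cos_fejer_kernel N0.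
(* Large enough for [N / m <= e], and positive by the successor. The frequencies [j * a] with
   [j < m] then stay in [-N, N]. *)
pose m := (Num.bound (N / e)).+1.
have m0 : 0 < m%:R :> R by rewrite ltr0n.
pose a := N / m%:R.
have ae : `|a| <= e.
  rewrite ger0_norm; last by rewrite divr_ge0// ltW.
  rewrite ler_pdivrMr// mulrC -ler_pdivrMr// ltW// (lt_trans (archi_boundP _)) ?ltr_nat//.
  by rewrite divr_ge0// ltW.
have iK := L1_fejer_kernel a.
pose P (h : R -> R) := [/\ bounded_meas h,
  convol f1 (fun s => h s * K a s) y @[y --> +oo] --> 0 &
  convol f2 (fun s => h s * K a s) y @[y --> +oo] --> 0].
have [_ P1 P2] : P (fun t => fejer_sum m (a * t)).
  apply: fejer_sum_ind => //.
  - move=> h1 h2 [bh1 h11 h12] [bh2 h21 h22].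
    have j1 := L1_bmM bh1 iK; have j2 := L1_bmM bh2 iK.
    have E f : bounded_meas f -> convol f (fun s => (h1 s + h2 s) * K a s) =
      (fun y => convol f (fun s => h1 s * K a s) y + convol f (fun s => h2 s * K a s) y).
      move=> bf; apply/funext => y; rewrite -(convDr y bf j1 j2); congr (convol f _ y).
      by apply/funext => s; rewrite mulrDl.
    by split; [exact: bmD|rewrite (E _ b1) -(addr0 0); exact: cvgD|
      rewrite (E _ b2) -(addr0 0); exact: cvgD].
  - move=> k h [bh h11 h12]; have j := L1_bmM bh iK.
    have E f : bounded_meas f -> convol f (fun s => (k * h s) * K a s) =
      (fun y => k * convol f (fun s => h s * K a s) y).
      move=> bf; apply/funext => y; rewrite -(convZr k y bf j); congr (convol f _ y).
      by apply/funext => s; rewrite mulrA.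
    split; first by apply: bmM => //; exact: bm_cst.
    + by rewrite (E _ b1) -(mulr0 k); apply: cvgM => //; exact: cvg_cst.
    + by rewrite (E _ b2) -(mulr0 k); apply: cvgM => //; exact: cvg_cst.
  - move=> j jm.
    have -> : (fun t => cos (j%:R * (a * t))) = (fun t => cos ((j%:R * a) * t)).
      by apply/funext => s; rewrite mulrA.
    have jN : `|j%:R * a| <= N.
      rewrite ger0_norm; last by rewrite mulr_ge0// divr_ge0// ltW.
      by rewrite /a mulrCA ler_piMr ?(ltW N0)// ler_pdivrMr// mul1r ler_nat ltnW.
    have [h1 h2] := He (j%:R * a) a jN ae.
    by split; [exact: bm_cos| |].
have NE : N = m%:R * a by rewrite /a mulrC divfK// gt_eqF.
have KE : K N = (fun s => fejer_sum m (a * s) * K a s).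
  by apply/funext => s; rewrite NE fejer_kernel_sum.
by rewrite KE.
Qed.

Theorem wiener_tauberian q : L1 q ->
  convol f1 q y @[y --> +oo] --> 0 /\ convol f2 q y @[y --> +oo] --> 0.
Proof.
move=> iq; split; apply: conv_cvg0_fejer => // n.
- by have [] := @cvg0_fejer_kernel n.+1%:R (ltr0Sn _ n).
- by have [] := @cvg0_fejer_kernel n.+1%:R (ltr0Sn _ n).
Qed.

End Wiener.
End WienerTheorem.

(** * The substitution t = e^s for nonnegative functions *)

Section ExpSubstitution.
Context {R : realType}.
Local Notation mu := (@lebesgue_measure R).
Local Notation D := (`]0, +oo[%classic : set R).
Implicit Types (h : R -> R).

(* [dt/t] and the image of Lebesgue measure under [expR] are both invariant under
   dilations, hence proportional: integrate [h t / t * box (s - ln t)] in both orders. *)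

Let posV (t : R) : R := \1_D t * expR (- ln t).

Let posV_ge0 t : 0 <= posV t.
Proof. by rewrite /posV mulr_ge0 ?expR_ge0. Qed.

Let posVE t : 0 < t -> posV t = t^-1.
Proof.
move=> t0; rewrite /posV indicE mem_set/= ?in_itv/= ?t0// mul1r expRN.
by rewrite lnK// posrE.
Qed.

Let posV0 t : t <= 0 -> posV t = 0.
Proof.
move=> t0; rewrite /posV indicE memNset ?mul0r//= in_itv/= andbT.
by apply/negP; rewrite -leNgt.
Qed.

(** The reason why [1/t] is written [expR (- ln t)] in [posV]: measurability is then obtained by
    composition. *)
Let measurable_posV : measurable_fun setT posV.
Proof.
apply: measurable_funM; first by apply: measurable_indic; exact: measurable_itv.
apply: measurableT_comp; first exact: measurable_expR.
by apply: measurableT_comp => //; exact: measurable_ln.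
Qed.

Let box (s : R) : R := \1_`[0, 1] s.

Let box_ge0 s : 0 <= box s. Proof. by []. Qed.

Let measurable_box : measurable_fun setT box.
Proof. by apply: measurable_indic; exact: measurable_itv. Qed.

Let integral_box : (\int[mu]_s (box s)%:E = 1)%E.
Proof.
by rewrite /box integral_indic//= setIT lebesgue_measure_itv/= lte_fin ltr01 oppr0 adde0.
Qed.

(** Fixes the constant of proportionality between the two measures: the integral of [1/u] from [1/e]
    to 1 equals 1. *)
Let integral_posV_box : (\int[mu]_u (posV u * box (- ln u))%:E = 1)%E.
Proof.
have e10 : 0 < expR (-1) :> R by exact: expR_gt0.
have e1 : expR (-1) < 1 :> R by rewrite expR_lt1 ltrN10.
transitivity (\int[mu]_(u in `[expR (- 1%R), 1%R]) (u^-1)%:E)%E.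
  rewrite [RHS]integral_mkcond; apply: eq_integral => u _; rewrite patchE.
  have [u0|u0] := ltP 0 u; last first.
    rewrite posV0// mul0r ifF//; apply/negbTE/negP => /set_mem/=.
    by rewrite in_itv/= => /andP[eu _]; have := lt_le_trans e10 eu; rewrite ltNge u0.
  rewrite posVE// /box indicE.
  have -> : (- ln u \in `[0, 1]%classic) = (u \in `[expR (-1), 1]%classic).
    have : expR (ln u) = u by rewrite lnK// posrE.
    move: (ln u) => L <-.
    apply/idP/idP => /set_mem/=; rewrite in_itv/= => /andP[h1 h2]; apply/mem_set; rewrite /= in_itv/=.
    - by rewrite ler_expR expR_le1; apply/andP; split; lra.
    - by move: h1 h2; rewrite ler_expR expR_le1 => h1 h2; apply/andP; split; lra.
  by case: ifP => _; rewrite ?mulr1 ?mulr0.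
have dln (x : R) : 0 < x -> derivable (@ln R) x 1.
  by move=> x0; apply: ex_derive; exact: is_derive1_ln.
rewrite (@continuous_FTC2 R (fun u => u^-1) (@ln R))//.
- by rewrite ln1 expRK -EFinB sub0r opprK.
- apply: continuous_in_subspaceT => x /set_mem/=; rewrite in_itv/= => /andP[x1 _].
  by apply: inv_continuous; rewrite gt_eqF// (lt_le_trans e10).
- split.
  + by move=> x; rewrite in_itv/= => /andP[x1 _]; apply: dln; exact: lt_trans x1.
  + by apply: cvg_at_right_filter; exact: continuous_ln.
  + by apply: cvg_at_left_filter; exact: continuous_ln.
- move=> x; rewrite in_itv/= => /andP[x1 _].
  have x0 := lt_trans e10 x1.
  by rewrite derive1E; have := is_derive1_ln x0 => dx; rewrite derive_val.
Qed.

Lemma ge0_integral_expR h : measurable_fun setT h -> (forall t, 0 <= h t) ->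
  (\int[mu]_(t in D) (h t / t)%:E = \int[mu]_s (h (expR s))%:E)%E.
Proof.
move=> mh h0.
have mbox2 (phi : R * R -> R) : measurable_fun setT phi -> measurable_fun setT (box \o phi).
  by move=> mphi; apply: measurableT_comp.
pose Phi (z : R * R) : \bar R := (h z.1 * posV z.1 * box (z.2 - ln z.1))%:E.
have mPhi : measurable_fun setT Phi.
  apply/measurable_EFinP; apply: measurable_funM; first apply: measurable_funM.
  - exact: measurable_comp_fst.
  - exact: measurable_comp_fst.
  - apply: mbox2; apply: measurable_funB; first exact: measurable_snd.
    by apply: measurable_comp_fst; exact: measurable_ln.
have Phi0 z : (0 <= Phi z)%E by rewrite lee_fin !mulr_ge0.
(* Inserts the factor 1, as the integral over [s] of a translate of [box]. *)
transitivity (\int[mu]_t \int[mu]_s Phi (t, s))%E.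
  rewrite [LHS]integral_mkcond; apply: eq_integral => t _; rewrite patchE /Phi/=.
  transitivity ((h t * posV t)%:E * \int[mu]_s (box (s - ln t))%:E)%E.
    have -> : (\int[mu]_s (box (s - ln t))%:E = 1)%E.
      rewrite -integral_box (ge0_integral_affine_pos (- ln t) (a := 1) (h := fun s => (box s)%:E))//.
      + by rewrite mul1e; apply: eq_integral => s _; rewrite mul1r.
      + exact/measurable_EFinP.
    rewrite mule1; case: ifPn => [/set_mem/=|/negP tD].
      by rewrite in_itv/= andbT => t0; rewrite posVE.
    rewrite posV0 ?mulr0// leNgt; apply/negP => t0; apply: tD.
    by apply/mem_set; rewrite /= in_itv/= t0.
  rewrite -ge0_integralZl_EFin//.
  - by move=> s _; rewrite lee_fin.
  - by apply/measurable_EFinP; apply: measurableT_comp => //; exact: measurable_funB.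
  - by rewrite mulr_ge0.
rewrite (@fubini_tonelli _ _ _ _ R mu mu Phi mPhi Phi0).
pose Psi (z : R * R) : \bar R := (h (expR z.1 * z.2) * posV z.2 * box (- ln z.2))%:E.
have mPsi : measurable_fun setT Psi.
  apply/measurable_EFinP; apply: measurable_funM; first apply: measurable_funM.
  - apply: measurableT_comp => //; apply: measurable_funM; last exact: measurable_snd.
    by apply: measurable_comp_fst; exact: measurable_expR.
  - exact: measurable_comp_snd.
  - apply: mbox2; apply: measurableT_comp => //.
    by apply: measurable_comp_snd; exact: measurable_ln.
have Psi0 z : (0 <= Psi z)%E by rewrite lee_fin !mulr_ge0.
(* The substitution [t = expR s * u] preserves [dt/t] and turns [box (s - ln t)] into
   [box (- ln u)], which is free of [s]. *)
transitivity (\int[mu]_s \int[mu]_u Psi (s, u))%E.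
  apply: eq_integral => s _.
  have mPs : measurable_fun setT (fun t => Phi (t, s)) by exact: measurable_fun_pair1.
  rewrite (ge0_integral_affine_pos 0 (expR_gt0 s) mPs)//.
  rewrite -(ge0_integralZl_EFin mu measurableT (fun _ _ => Phi0 _)
    (measurableT_comp mPs (measurable_affine (expR s) 0)) (expR_ge0 s)).
  apply: eq_integral => u _; rewrite /Phi /Psi/= addr0 -EFinM; congr EFin.
  have [u0|u0] := ltP 0 u; last first.
    by rewrite (posV0 u0) posV0 ?mulr0 ?mul0r ?mulr0// mulr_ge0_le0// expR_ge0.
  rewrite posVE ?mulr_gt0 ?expR_gt0// posVE// lnM ?posrE ?expR_gt0// expRK.
  have -> : s - (s + ln u) = - ln u by ring.
  have es : expR s != 0 by rewrite gt_eqF// expR_gt0.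
  by field; rewrite es gt_eqF.
rewrite (@fubini_tonelli _ _ _ _ R mu mu Psi mPsi Psi0).
(* Since [expR s * u = expR (s + ln u)], translating [s] by [ln u] makes the inner integral
   independent of [u]. *)
transitivity (\int[mu]_u ((posV u * box (- ln u))%:E * \int[mu]_s (h (expR s))%:E))%E.
  apply: eq_integral => u _; rewrite /Psi/=.
  have [u0|u0] := ltP 0 u; last first.
    rewrite posV0// mul0r mul0e; under eq_integral do rewrite mulr0 mul0r.
    by rewrite integral0.
  have mhe : measurable_fun setT (fun s => (h (expR s))%:E).
    by apply/measurable_EFinP; apply: measurableT_comp => //; exact: measurable_expR.
  rewrite (ge0_integral_affine_pos (ln u) (a := 1) (h := fun s => (h (expR s))%:E))//; last first.
    by move=> s; rewrite lee_fin.
  rewrite mul1e -(ge0_integralZl_EFin mu measurableT _ (measurableT_comp mhe (measurable_affine 1 (ln u)))).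
  - apply: eq_integral => s _ /=; rewrite mul1r expRD lnK ?posrE// -EFinM; congr EFin; ring.
  - by move=> s _; rewrite lee_fin.
  - by rewrite mulr_ge0.
rewrite ge0_integralZr//.
- by rewrite integral_posV_box mul1e.
- apply/measurable_EFinP; apply: measurable_funM => //; apply: measurableT_comp => //.
  by apply: measurableT_comp => //; exact: measurable_ln.
- by move=> u _; rewrite lee_fin mulr_ge0.
- by apply: integral_ge0 => s _; rewrite lee_fin.
Qed.

End ExpSubstitution.

(** * Integrals against dt/t and limits at infinity in the logarithmic variable *)

Section MultiplicativeHaar.
Context {R : realType}.
Local Notation mu := (@lebesgue_measure R).
Local Notation D := (`]0, +oo[%classic : set R).
Implicit Types (h : R -> R).

Lemma Rintegral_expR h : measurable_fun setT h ->
  \int[mu]_(t in D) (h t / t) = \int[mu]_s h (expR s).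
Proof.
move=> mh; rewrite /Rintegral; congr fine; rewrite integralE [RHS]integralE.
have mpos : measurable_fun setT (fun t => Num.max (h t) 0) by exact: measurable_maxr.
have mneg : measurable_fun setT (fun t => Num.max (- h t) 0).
  by apply: measurable_maxr => //; exact: measurableT_comp.
congr (_ - _)%E.
- transitivity (\int[mu]_(t in D) (Num.max (h t) 0 / t)%:E)%E.
    apply: eq_integral => t /set_mem/=; rewrite in_itv/= andbT => t0.
    by rewrite funeposE -EFin_max maxr_pMl ?invr_ge0 ?(ltW t0)// mul0r.
  rewrite (ge0_integral_expR mpos); last by move=> t; rewrite le_max lexx orbT.
  by apply: eq_integral => s _; rewrite funeposE -EFin_max.
- transitivity (\int[mu]_(t in D) (Num.max (- h t) 0 / t)%:E)%E.
    apply: eq_integral => t /set_mem/=; rewrite in_itv/= andbT => t0.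
    by rewrite funenegE -EFinN -EFin_max maxr_pMl ?invr_ge0 ?(ltW t0)// mul0r mulNr.
  rewrite (ge0_integral_expR mneg); last by move=> t; rewrite le_max lexx orbT.
  by apply: eq_integral => s _; rewrite funenegE -EFinN -EFin_max.
Qed.

Lemma L1_expR h : measurable_fun setT h -> mu.-integrable D (fun t => (h t / t)%:E) ->
  L1 (fun s => h (expR s)).
Proof.
move=> mh /integrableP[_ ih]; apply: L1P.
  by apply: measurableT_comp => //; exact: measurable_expR.
have mhn : measurable_fun setT (fun t => `|h t|) by exact: measurableT_comp.
rewrite -(ge0_integral_expR mhn)//; apply: le_lt_trans ih.
rewrite le_eqVlt; apply/orP; left; apply/eqP.
apply: eq_integral => t /set_mem/=; rewrite in_itv/= andbT => t0.
by rewrite /= normrM (gtr0_norm (x := t^-1)) ?invr_gt0.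
Qed.

Lemma cvg_expRP (F : R -> R) (l : R) :
  F x @[x --> +oo] --> l <-> F (expR y) @[y --> +oo] --> l.
Proof.
split=> Fl.
- apply: (cvg_comp (@expR R) F _ Fl); apply/cvgryPge => A.
  near=> y; apply: (@le_trans _ _ (1 + y)); last exact: expR_ge1Dx.
  have : A <= y by near: y; apply: nbhs_pinfty_ge; rewrite num_real.
  lra.
- have lny : @ln R x @[x --> +oo] --> +oo%R.
    apply/cvgryPge => A; near=> x.
    have xA : expR A <= x by near: x; apply: nbhs_pinfty_ge; rewrite num_real.
    by rewrite -(expRK A) ler_ln ?posrE ?expR_gt0// (lt_le_trans _ xA)// expR_gt0.
  apply: cvg_trans (cvg_comp (@ln R) (fun y => F (expR y)) lny Fl).
  apply: near_eq_cvg; near=> x; rewrite /= lnK// posrE.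
  by near: x; apply: nbhs_pinfty_gt; rewrite num_real.
Unshelve. all: end_near. Qed.

Lemma measurable_invr_pos : measurable_fun D (fun t : R => t^-1).
Proof.
apply: (@eq_measurable_fun _ _ _ _ _ (fun t : R => expR (- ln t))).
  move=> t /set_mem/=; rewrite in_itv/= andbT => t0.
  by rewrite expRN lnK// posrE.
apply: measurable_funTS; apply: measurableT_comp; first exact: measurable_expR.
by apply: measurableT_comp => //; exact: measurable_ln.
Qed.

Lemma ae_Rintegral_div h1 h2 : measurable_fun setT h1 -> measurable_fun setT h2 ->
  {ae mu, forall t, h1 t = h2 t} ->
  \int[mu]_(t in D) (h1 t / t) = \int[mu]_(t in D) (h2 t / t).
Proof.
move=> m1 m2 h12; rewrite /Rintegral; congr fine; apply: ae_eq_integral => //.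
- apply/measurable_EFinP; apply: measurable_funM; last exact: measurable_invr_pos.
  exact: measurable_funTS.
- apply/measurable_EFinP; apply: measurable_funM; last exact: measurable_invr_pos.
  exact: measurable_funTS.
- case: h12 => N [mN N0 sN]; exists N; split=> // t /= nt.
  by apply: sN => /= e; apply: nt => _; rewrite e.
Qed.

End MultiplicativeHaar.

(** * Translation of the hypotheses to the additive line *)

Section Reduction.
Context {R : realType}.
Local Notation mu := (@lebesgue_measure R).
Local Notation D := (`]0, +oo[%classic : set R).
Local Notation D1 := (`[1, +oo[%classic : set R).
Implicit Types (h g : R -> R) (psi f : R -> R[i]).

Definition ext1 g (t : R) : R := if 1 <= t then g t else 0.

Lemma ext1E g : ext1 g = g \_ D1.
Proof.
apply/funext => t; rewrite patchE /ext1; case: ifPn => t1.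
  by rewrite mem_set//= in_itv/= t1.
by rewrite memNset//= in_itv/= (negbTE t1).
Qed.

Lemma Re_ext_tilde psi t : complex.Re (ext_tilde psi t) = ext1 (fun t => complex.Re (psi t)) t.
Proof. by rewrite /ext_tilde /ext1; case: ifP. Qed.

Lemma Im_ext_tilde psi t : complex.Im (ext_tilde psi t) = ext1 (fun t => complex.Im (psi t)) t.
Proof. by rewrite /ext_tilde /ext1; case: ifP. Qed.

Lemma measurable_ext1 g : measurable_fun D1 g -> measurable_fun setT (ext1 g).
Proof. by rewrite ext1E => mg; apply/(measurable_restrictT _ _).1. Qed.

(** Integrability speaks of [g t / t]; multiplying back by [t], which is nonzero on [1, oo),
    recovers [g]. *)
Lemma measurable_ext1_div g : mu.-integrable D1 (fun t => (g t / t)%:E) ->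
  measurable_fun setT (ext1 g).
Proof.
move=> /measurable_int/measurable_EFinP mg.
have -> : ext1 g = ext1 (fun t => g t / t * t).
  apply/funext => t; rewrite /ext1; case: ifPn => // t1.
  by rewrite divfK// gt_eqF// (lt_le_trans _ t1).
by apply: measurable_ext1; exact: measurable_funM.
Qed.

Lemma L1_ext1_expR g : mu.-integrable D1 (fun t => (g t / t)%:E) ->
  L1 (fun s => ext1 g (expR s)).
Proof.
move=> ig; apply: (L1_expR (measurable_ext1_div ig)).
have mD1 : measurable D1 by exact: measurable_itv.
have ir : L1 (fun t => ext1 g t / t).
  have -> : (fun t => ext1 g t / t) = (fun t => g t / t) \_ D1.
    by rewrite -ext1E; apply/funext => t; rewrite /ext1; case: ifP => // _; rewrite mul0r.
  by rewrite /L1 -restrict_EFin; exact: ((@integrable_mkcond _ (measurableTypeR R) _ mu D1 _ mD1).1 ig).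
by apply: integrableS ir.
Qed.

Lemma Rintegral_ext1 g : mu.-integrable D1 (fun t => (g t / t)%:E) ->
  \int[mu]_s ext1 g (expR s) = \int[mu]_(t in D1) (g t / t).
Proof.
move=> ig; rewrite -(Rintegral_expR (measurable_ext1_div ig)) Rintegral_mkcond [RHS]Rintegral_mkcond.
apply: eq_Rintegral => t _; rewrite -ext1E patchE /ext1; case: ifPn => [/set_mem/=|/negP tD].
  by case: ifP => // _ _; rewrite mul0r.
case: ifP => // t1; exfalso; apply: tD; apply/mem_set; rewrite /= in_itv/= andbT.
exact: lt_le_trans t1.
Qed.

Lemma ReM (a b : R[i]) :
  complex.Re (a * b) = complex.Re a * complex.Re b - complex.Im a * complex.Im b.
Proof. by case: a => ? ?; case: b. Qed.

Lemma ImM (a b : R[i]) :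
  complex.Im (a * b) = complex.Re a * complex.Im b + complex.Im a * complex.Re b.
Proof. by case: a => ? ?; case: b. Qed.

(** With [t = expR s] the factor [t^{-ix}] becomes [e^{-ixs}], so the Mellin-type transform is the
    Fourier transform of [P1 + i P2] at [x]. *)
Lemma hat_ext_tilde psi x : cL1 (@Rplus_mul R) psi ->
  let P1 s := ext1 (fun t => complex.Re (psi t)) (expR s) in
  let P2 s := ext1 (fun t => complex.Im (psi t)) (expR s) in
  hat (ext_tilde psi) x =
  Complex (\int[mu]_s mod_re x P1 P2 s) (\int[mu]_s mod_im x P1 P2 s).
Proof.
move=> [i1 i2] P1 P2.
have m1 := measurable_ext1_div i1; have m2 := measurable_ext1_div i2.
have mc : measurable_fun setT (fun t : R => cos (x * ln t)).
  apply: measurableT_comp; first exact: measurable_cos.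
  by apply: measurable_funM => //; exact: measurable_ln.
have ms : measurable_fun setT (fun t : R => sin (x * ln t)).
  apply: measurableT_comp; first exact: measurable_sin.
  by apply: measurable_funM => //; exact: measurable_ln.
rewrite /hat /cint_dt; congr Complex.
- pose h t := cos (x * ln t) * ext1 (fun t => complex.Re (psi t)) t +
     sin (x * ln t) * ext1 (fun t => complex.Im (psi t)) t.
  have mh : measurable_fun setT h by apply: measurable_funD; apply: measurable_funM.
  transitivity (\int[mu]_(t in D) (h t / t)).
    apply: eq_Rintegral => t _; rewrite ReM Re_ext_tilde Im_ext_tilde /h /=; congr (_ / _); ring.
  rewrite (Rintegral_expR mh); apply: eq_Rintegral => s _.
  by rewrite /h /mod_re expRK.
- pose h t := cos (x * ln t) * ext1 (fun t => complex.Im (psi t)) t -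
     sin (x * ln t) * ext1 (fun t => complex.Re (psi t)) t.
  have mh : measurable_fun setT h by apply: measurable_funB; apply: measurable_funM.
  transitivity (\int[mu]_(t in D) (h t / t)).
    apply: eq_Rintegral => t _; rewrite ImM Re_ext_tilde Im_ext_tilde /h /=; congr (_ / _); ring.
  rewrite (Rintegral_expR mh); apply: eq_Rintegral => s _.
  by rewrite /h /mod_im expRK.
Qed.

(* The integrals defining the two methods only see [f] up to null sets, so [f] may be
   replaced by the components [f1, f2] of a bounded function. *)
Lemma cint_dt_expR (E : set R) psi f (f1 f2 k k' : R -> R) :
  cL1 (@Rplus_mul R) psi ->
  measurable_fun D1 (fun t => complex.Re (f t)) -> measurable_fun D1 (fun t => complex.Im (f t)) ->
  measurable_fun setT f1 -> measurable_fun setT f2 ->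
  {ae mu, forall t, ext1 (fun t => complex.Re (f t)) t = f1 t /\
                    ext1 (fun t => complex.Im (f t)) t = f2 t} ->
  measurable_fun setT k ->
  (forall t, E t -> [/\ 1 <= t, k' t = k t & 1 <= k t]) ->
  (forall t, 1 <= t -> ~ E t -> k t < 1) ->
  let p1 := ext1 (fun t => complex.Re (psi t)) in
  let p2 := ext1 (fun t => complex.Im (psi t)) in
  cint_dt E (fun t => f t * psi (k' t)) =
  Complex (\int[mu]_s (f1 (expR s) * p1 (k (expR s)) - f2 (expR s) * p2 (k (expR s))))
          (\int[mu]_s (f1 (expR s) * p2 (k (expR s)) + f2 (expR s) * p1 (k (expR s)))).
Proof.
move=> [i1 i2] mf1 mf2 m1 m2 ff mk Ek Ek' p1 p2.
have mp1 := measurable_ext1_div i1; have mp2 := measurable_ext1_div i2.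
have me1 := measurable_ext1 mf1; have me2 := measurable_ext1 mf2.
set e1 := ext1 _ in me1; set e2 := ext1 _ in me2.
have mpk (p : R -> R) : measurable_fun setT p -> measurable_fun setT (fun t => p (k t)).
  by move=> mp; exact: (measurableT_comp mp mk).
(* Off [E] one of the two factors vanishes: the extension of [f] when [t < 1], that of [psi] when
   [k t < 1]. The two extensions thus encode the domain [E], and the integral can be taken over (0,
   oo). *)
have out t : ~ E t -> 0 < t -> (e1 t = 0 /\ e2 t = 0) \/ (p1 (k t) = 0 /\ p2 (k t) = 0).
  move=> nE t0; have [t1|t1] := leP 1 t.
    by right; have := Ek' t t1 nE; rewrite /p1 /p2 /ext1 ltNge => /negbTE ->.
  by left; rewrite /e1 /e2 /ext1 leNgt t1.
have step (q h : R -> R) : (forall t, E t -> q t = h t) ->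
    (forall t, ~ E t -> 0 < t -> h t = 0) ->
    \int[mu]_(t in E) (q t / t) = \int[mu]_(t in D) (h t / t).
  move=> qh h0; rewrite Rintegral_mkcond [RHS]Rintegral_mkcond; apply: eq_Rintegral => t _.
  rewrite !patchE; case: ifPn => [/set_mem tE|/negP tE].
    have [t1 _ _] := Ek t tE.
    by rewrite mem_set ?qh//= in_itv/= andbT (lt_le_trans _ t1).
  case: ifPn => // /set_mem/=; rewrite in_itv/= andbT => t0.
  by rewrite h0 ?mul0r// => tE'; apply: tE; exact/mem_set.
rewrite /cint_dt; congr Complex.
- rewrite (step _ (fun t => e1 t * p1 (k t) - e2 t * p2 (k t))); first last.
  + by move=> t nE t0; have [[-> ->]|[-> ->]] := out t nE t0; rewrite ?mul0r ?mulr0 subrr.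
  + by move=> t tE; have [t1 kk k1] := Ek t tE; rewrite ReM kk /e1 /e2 /p1 /p2 /ext1 t1 k1.
  rewrite (@ae_Rintegral_div _ _ (fun t => f1 t * p1 (k t) - f2 t * p2 (k t))).
  + rewrite Rintegral_expR//; apply: measurable_funB; apply: measurable_funM => //; exact: mpk.
  + by apply: measurable_funB; apply: measurable_funM => //; exact: mpk.
  + by apply: measurable_funB; apply: measurable_funM => //; exact: mpk.
  + case: ff => N [mN N0 sN]; exists N; split=> // t /= nt.
    by apply: sN => /= -[h1 h2]; apply: nt; rewrite /e1 /e2 h1 h2.
- rewrite (step _ (fun t => e1 t * p2 (k t) + e2 t * p1 (k t))); first last.
  + by move=> t nE t0; have [[-> ->]|[-> ->]] := out t nE t0; rewrite ?mul0r ?mulr0 addr0.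
  + by move=> t tE; have [t1 kk k1] := Ek t tE; rewrite ImM kk /e1 /e2 /p1 /p2 /ext1 t1 k1.
  rewrite (@ae_Rintegral_div _ _ (fun t => f1 t * p2 (k t) + f2 t * p1 (k t))).
  + rewrite Rintegral_expR//; apply: measurable_funD; apply: measurable_funM => //; exact: mpk.
  + by apply: measurable_funD; apply: measurable_funM => //; exact: mpk.
  + by apply: measurable_funD; apply: measurable_funM => //; exact: mpk.
  + case: ff => N [mN N0 sN]; exists N; split=> // t /= nt.
    by apply: sN => /= -[h1 h2]; apply: nt; rewrite /e1 /e2 h1 h2.
Qed.

(** [f] is replaced by 0 at the points where the essential bound fails; these form a measurable set,
    negligible for [mu]. *)
Lemma bounded_representative f : cLinfty (@Rplus_mul R) f -> exists f1 f2 : R -> R,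
  [/\ bounded_meas f1, bounded_meas f2 &
      {ae mu, forall t, ext1 (fun t => complex.Re (f t)) t = f1 t /\
                        ext1 (fun t => complex.Im (f t)) t = f2 t}].
Proof.
move=> [mf1 [mf2 [M fM]]].
have me1 := measurable_ext1 mf1; have me2 := measurable_ext1 mf2.
set e1 := ext1 _ in me1 *; set e2 := ext1 _ in me2 *.
pose b t := e1 t ^+ 2 + e2 t ^+ 2 <= M.
have mb : measurable_fun setT b.
  by apply: measurable_fun_ler => //; apply: measurable_funD; exact: measurable_funX.
(* [u ^+ 2 <= M] implies [|u| <= |M| + 1], a bound that avoids the square root. *)
have bd (u v : R) : `|if u ^+ 2 + v ^+ 2 <= M then u else 0| <= `|M| + 1.
  case: ifP => [h|_]; last by rewrite normr0 addr_ge0.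
  have := real_normK (num_real u); have := normr_ge0 u; have := ler_norm M.
  by have := sqr_ge0 v; nra.
exists (fun t => if b t then e1 t else 0), (fun t => if b t then e2 t else 0); split.
- split; first exact: measurable_fun_ifT.
  by exists (`|M| + 1) => t; exact: bd.
- split; first exact: measurable_fun_ifT.
  by exists (`|M| + 1) => t; rewrite /b addrC; exact: bd.
- case: fM => N [mN N0 sN]; exists N; split=> // t /= nt.
  apply: sN => /= h; apply: nt.
  have [t1|t1] := boolP (1 <= t); last by rewrite /e1 /e2 /ext1 (negbTE t1) !if_same.
  have := h; rewrite /Rplus_mul/= in_itv/= t1 => /(_ isT) hM.
  by rewrite ifT ?ifT// /b /e1 /e2 /ext1 t1.
Qed.

End Reduction.

(** * The two summability methods as convolutions *)

Section SummabilityMethods.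
Context {R : realType}.
Local Notation mu := (@lebesgue_measure R).
Implicit Types (f p q : R -> R).

Lemma conv_pairE (f1 f2 p1 p2 : R -> R) y : bounded_meas f1 -> bounded_meas f2 ->
  L1 p1 -> L1 p2 ->
  convol f1 p1 y - convol f2 p2 y = \int[mu]_s (f1 s * p1 (y - s) - f2 s * p2 (y - s)) /\
  convol f1 p2 y + convol f2 p1 y = \int[mu]_s (f1 s * p2 (y - s) + f2 s * p1 (y - s)).
Proof.
move=> b1 b2 i1 i2; rewrite !conv_sym//.
have j g q : bounded_meas g -> L1 q -> L1 (fun s => g s * q (y - s)).
  by move=> bg iq; apply: L1_bmM => //; exact: L1_rev.
by rewrite (RintegralB measurableT (j _ _ b1 i1) (j _ _ b2 i2))
  (RintegralD measurableT (j _ _ b1 i2) (j _ _ b2 i1)).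
Qed.

(** The kernel has integral [1 + 0 i], so convolving the constant [alpha] with it returns [alpha],
    and subtracting [alpha] from [f] moves the limit to 0. The formula for [T] is needed only near
    infinity, whence [0 <= y]. *)
Lemma clim_pinfty_convP (T : R -> R[i]) (alpha : R[i]) (f1 f2 p1 p2 : R -> R) :
  bounded_meas f1 -> bounded_meas f2 -> L1 p1 -> L1 p2 ->
  \int[mu]_s p1 s = 1 -> \int[mu]_s p2 s = 0 ->
  (forall y, 0 <= y -> T (expR y) = Complex (convol f1 p1 y - convol f2 p2 y)
                                           (convol f1 p2 y + convol f2 p1 y)) ->
  let g1 s := f1 s - complex.Re alpha in
  let g2 s := f2 s - complex.Im alpha in
  clim_pinfty T alpha <->
  (convol g1 p1 y - convol g2 p2 y) @[y --> +oo] --> 0 /\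
  (convol g1 p2 y + convol g2 p1 y) @[y --> +oo] --> 0.
Proof.
move=> b1 b2 i1 i2 p1E p2E TE g1 g2.
have cc (a : R) q y : L1 q -> convol (fun=> a) q y = a * \int[mu]_s q s.
  by move=> iq; rewrite -(RintegralZl _ measurableT iq).
have gE f (a : R) q y : bounded_meas f -> L1 q ->
    convol (fun s => f s - a) q y = convol f q y - a * \int[mu]_s q s.
  by move=> bf iq; rewrite (convBl y bf (bm_cst a) iq) cc.
have reE : (fun y => convol g1 p1 y - convol g2 p2 y) =
    (fun y => (convol f1 p1 y - convol f2 p2 y) - complex.Re alpha).
  by apply/funext => y; rewrite !gE// p1E p2E mulr1 mulr0 subr0 addrAC.
have imE : (fun y => convol g1 p2 y + convol g2 p1 y) =
    (fun y => (convol f1 p2 y + convol f2 p1 y) - complex.Im alpha).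
  by apply/funext => y; rewrite !gE// p1E p2E mulr1 mulr0 subr0 addrA.
have equiv (F G : R -> R) (a : R) : (forall y, 0 <= y -> F (expR y) = G y) ->
    F x @[x --> +oo] --> a <-> (G y - a) @[y --> +oo] --> 0.
  move=> FG; rewrite cvg_expRP.
  have near_FG : \forall y \near +oo, F (expR y) = G y.
    have : \forall y \near +oo, (0 : R) <= y by apply: nbhs_pinfty_ge; rewrite num_real.
    by apply: filterS => y; exact: FG.
  rewrite -subr_cvg0; split; apply: cvg_trans; apply: near_eq_cvg;
    by apply: filterS near_FG => y /= ->.
rewrite /clim_pinfty reE imE.
have e1 := equiv (fun x => complex.Re (T x)) (fun y => convol f1 p1 y - convol f2 p2 y)
  (complex.Re alpha) (fun y y0 => congr1 (@complex.Re R) (TE y y0)).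
have e2 := equiv (fun x => complex.Im (T x)) (fun y => convol f1 p2 y + convol f2 p1 y)
  (complex.Im alpha) (fun y y0 => congr1 (@complex.Im R) (TE y y0)).
by split=> -[/e1 h1 /e2 h2].
Qed.

(** With [t = expR s] and [x = expR y], the quotient [x / t] becomes [y - s] and [t / x] becomes
    [s - y]: the second kernel is the reflection of the first. For [0 <= y] the interval [x, oo)
    lies in [1, oo), the domain of [f]. *)
Lemma Mpsi_expR (psi f : R -> R[i]) (f1 f2 : R -> R) :
  cL1 (@Rplus_mul R) psi -> cLinfty (@Rplus_mul R) f ->
  bounded_meas f1 -> bounded_meas f2 ->
  {ae mu, forall t, ext1 (fun t => complex.Re (f t)) t = f1 t /\
                    ext1 (fun t => complex.Im (f t)) t = f2 t} ->
  let F1 s := f1 (expR s) in let F2 s := f2 (expR s) in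
  let P1 s := ext1 (fun t => complex.Re (psi t)) (expR s) in
  let P2 s := ext1 (fun t => complex.Im (psi t)) (expR s) in
  let Q1 s := P1 (- s) in let Q2 s := P2 (- s) in
  [/\ bounded_meas F1 /\ bounded_meas F2, (L1 P1 /\ L1 P2) /\ (L1 Q1 /\ L1 Q2),
   forall y, 0 <= y -> Mpsi psi f (expR y) =
     Complex (convol F1 P1 y - convol F2 P2 y) (convol F1 P2 y + convol F2 P1 y) &
   forall y, 0 <= y -> Mpsi_star psi f (expR y) =
     Complex (convol F1 Q1 y - convol F2 Q2 y) (convol F1 Q2 y + convol F2 Q1 y)].
Proof.
move=> ipsi [mf1 [mf2 _]] b1 b2 ff F1 F2 P1 P2 Q1 Q2.
have [i1 i2] := ipsi.
have bexp g : bounded_meas g -> bounded_meas (fun s : R => g (expR s)).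
  move=> [mg [M gM]]; split; last by exists M.
  by apply: measurableT_comp => //; exact: measurable_expR.
have bF1 : bounded_meas F1 by exact: bexp.
have bF2 : bounded_meas F2 by exact: bexp.
have iP1 : L1 P1 by exact: L1_ext1_expR.
have iP2 : L1 P2 by exact: L1_ext1_expR.
have iQ p : L1 p -> L1 (fun s => p (- s)).
  by move=> ip; apply: (eq_L1 _ (L1_rev 0 ip)) => s; rewrite sub0r.
have iQ1 := iQ _ iP1; have iQ2 := iQ _ iP2.
split=> // y y0.
(* The quotient [expR y / t] is replaced by [expR y * expR (- ln t)], equal to it for positive [t]
   and visibly measurable on the whole line. *)
- rewrite /Mpsi (@cint_dt_expR _ _ _ _ f1 f2 (fun t => expR y * expR (- ln t)) (fun t => expR y / t)
    ipsi mf1 mf2 b1.1 b2.1 ff).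
  + have [-> ->] := conv_pairE y bF1 bF2 iP1 iP2.
    by congr Complex; apply: eq_Rintegral => s _; rewrite expRK -expRD.
  + apply: measurable_funM => //; apply: measurableT_comp; first exact: measurable_expR.
    by apply: measurableT_comp => //; exact: measurable_ln.
  + move=> t /=; rewrite in_itv/= => /andP[t1 ty].
    have t0 : 0 < t by rewrite (lt_le_trans _ t1).
    by rewrite expRN lnK ?posrE//; split=> //; rewrite ler_pdivlMr// mul1r.
  + move=> t t1 /= /negP; rewrite in_itv/= t1/= -ltNge => ty.
    have t0 : 0 < t by rewrite (lt_le_trans _ t1).
    by rewrite expRN lnK ?posrE// ltr_pdivrMr// mul1r.
- rewrite /Mpsi_star (@cint_dt_expR _ _ _ _ f1 f2 (fun t => t / expR y) (fun t => t / expR y)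
    ipsi mf1 mf2 b1.1 b2.1 ff).
  + have [-> ->] := conv_pairE y bF1 bF2 iQ1 iQ2.
    by congr Complex; apply: eq_Rintegral => s _; rewrite /Q1 /Q2 opprB -expRN -expRD.
  + exact: mulrr_measurable.
  + move=> t /=; rewrite in_itv/= andbT => ty; split=> //.
      by rewrite (le_trans _ ty)// -expR0 ler_expR.
    by rewrite ler_pdivlMr ?expR_gt0// mul1r.
  + move=> t _ /= /negP; rewrite in_itv/= andbT -ltNge => ty.
    by rewrite ltr_pdivrMr ?expR_gt0// mul1r.
Qed.

End SummabilityMethods.

Theorem theorem4p4 (R : realType) (psi : R -> R[i]) :
  cL1 (@Rplus_mul R) psi ->
  cint_dt (@Rplus_mul R) psi = 1 ->
  Zset (ext_tilde psi) = set0 ->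
  forall (f : R -> R[i]), cLinfty (@Rplus_mul R) f ->
  forall alpha : R[i],
    clim_pinfty (Mpsi psi f) alpha <-> clim_pinfty (Mpsi_star psi f) alpha.
Proof.
move=> ipsi psi1 Z0 f bf alpha.
have [f1 [f2 [b1 b2 ff]]] := bounded_representative bf.
pose F1 s := f1 (expR s); pose F2 s := f2 (expR s).
pose P1 s := ext1 (fun t => complex.Re (psi t)) (expR s).
pose P2 s := ext1 (fun t => complex.Im (psi t)) (expR s).
pose Q1 s := P1 (- s); pose Q2 s := P2 (- s).
have [[bF1 bF2] [[iP1 iP2] [iQ1 iQ2]] ME MsE] :
  [/\ bounded_meas F1 /\ bounded_meas F2, (L1 P1 /\ L1 P2) /\ (L1 Q1 /\ L1 Q2),
   forall y, 0 <= y -> Mpsi psi f (expR y) =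
     Complex (convol F1 P1 y - convol F2 P2 y) (convol F1 P2 y + convol F2 P1 y) &
   forall y, 0 <= y -> Mpsi_star psi f (expR y) =
     Complex (convol F1 Q1 y - convol F2 Q2 y) (convol F1 Q2 y + convol F2 Q1 y)].
  exact: Mpsi_expR.
have [P1E P2E] : \int[lebesgue_measure]_s P1 s = 1 /\ \int[lebesgue_measure]_s P2 s = 0.
  have [i1 i2] := ipsi; rewrite (Rintegral_ext1 i1) (Rintegral_ext1 i2).
  by case: psi1.
have revE p : L1 p -> \int[lebesgue_measure]_s p (- s) = \int[lebesgue_measure]_s p s :> R.
  by move=> ip; rewrite -(Rintegral_rev 0 ip); apply: eq_Rintegral => s _; rewrite sub0r.
have nzP x : (\int[lebesgue_measure]_s mod_re x P1 P2 s) ^+ 2 +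
    (\int[lebesgue_measure]_s mod_im x P1 P2 s) ^+ 2 != 0.
  apply/negP; rewrite paddr_eq0 ?sqr_ge0// !sqrf_eq0 => /andP[/eqP re0 /eqP im0].
  have : Zset (ext_tilde psi) x by rewrite /Zset/= (hat_ext_tilde x ipsi) re0 im0.
  by rewrite Z0.
(* The transform of the reflected kernel at [x] is that of the original one at [- x]. *)
have nzQ x : (\int[lebesgue_measure]_s mod_re x Q1 Q2 s) ^+ 2 +
    (\int[lebesgue_measure]_s mod_im x Q1 Q2 s) ^+ 2 != 0.
  have := nzP (- x).
  rewrite -(revE _ (L1_mod_re (- x) iP1 iP2)) -(revE _ (L1_mod_im (- x) iP1 iP2)).
  have -> : (fun s => mod_re (- x) P1 P2 (- s)) = mod_re x Q1 Q2.
    by apply/funext => s; rewrite /mod_re mulrNN.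
  have -> // : (fun s => mod_im (- x) P1 P2 (- s)) = mod_im x Q1 Q2.
  by apply/funext => s; rewrite /mod_im mulrNN.
have Q1E : \int[lebesgue_measure]_s Q1 s = 1 by rewrite revE.
have Q2E : \int[lebesgue_measure]_s Q2 s = 0 by rewrite revE.
rewrite (clim_pinfty_convP alpha bF1 bF2 iP1 iP2 P1E P2E ME).
rewrite (clim_pinfty_convP alpha bF1 bF2 iQ1 iQ2 Q1E Q2E MsE).
set g1 := fun s => F1 s - _; set g2 := fun s => F2 s - _.
have bg1 : bounded_meas g1 by apply: bmB => //; exact: bm_cst.
have bg2 : bounded_meas g2 by apply: bmB => //; exact: bm_cst.
(* Wiener's theorem with arbitrary target kernel; exchanging the roles of the two kernels gives the
   two implications. *)
have transfer p1 p2 q1 q2 : L1 p1 -> L1 p2 -> L1 q1 -> L1 q2 ->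
    (forall x, (\int[lebesgue_measure]_s mod_re x p1 p2 s) ^+ 2 +
       (\int[lebesgue_measure]_s mod_im x p1 p2 s) ^+ 2 != 0) ->
    (convol g1 p1 y - convol g2 p2 y) @[y --> +oo] --> 0 /\
    (convol g1 p2 y + convol g2 p1 y) @[y --> +oo] --> 0 ->
    (convol g1 q1 y - convol g2 q2 y) @[y --> +oo] --> 0 /\
    (convol g1 q2 y + convol g2 q1 y) @[y --> +oo] --> 0.
  move=> i1 i2 j1 j2 nz [A0 B0].
  have [h11 h21] := wiener_tauberian bg1 bg2 i1 i2 nz A0 B0 j1.
  have [h12 h22] := wiener_tauberian bg1 bg2 i1 i2 nz A0 B0 j2.
  by split; [rewrite -(subr0 0); exact: cvgB|rewrite -(addr0 0); exact: cvgD].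
by split; [exact: (transfer P1 P2 Q1 Q2)|exact: (transfer Q1 Q2 P1 P2)].
Qed.
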